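(* Let $(X,d,\alpha)$ be a computable metric space and let $S$ and $T$ be semi-computable compact sets in this space such that $T\subseteq S$. Suppose $x\in S$ is a point which has a neighborhood $U$ (in $S$) with the following property: for some $n\ge1$ there exists a homeomorphism $f:\mathbb H^n\to U$ such that $f(\mathrm{Bd}\,\mathbb H^n)=U\cap T$. Then there exists a neighborhood of $x$ in $S$ which is computable up to $S$.
   Context: $\mathbb H^n=\{(x_1,\dots,x_n)\in\mathbb R^n:x_n\ge0\}$ and $\mathrm{Bd}\,\mathbb H^n=\{(x_1,\dots,x_n)\in\mathbb H^n: x_n=0\}$. A computable metric space is a triple $(X,d,\alpha)$ where $(X,d)$ is a metric space and $\alpha=(\alpha_i)_{i\in\mathbb N}$ is a sequence with dense range in $(X,d)$ such that $(i,j)\mapsto d(\alpha_i,\alpha_j)$ is a computable function $\mathbb N^2\to\mathbb R$ (a function $g:\mathbb N^k\to\mathbb R$ is computable if there is a computable $G:\mathbb N^{k+1}\to\mathbb Q$ with $|g(x)-G(x,i)|<2^{-i}$ for all $x,i$). Fix a computable $q:\mathbb N\to\mathbb Q$ whose image is the set of positive rationals and computable $\tau_1,\tau_2:\mathbb N\to\mathbb N$ with $\{(\tau_1(i),\tau_2(i)):i\in\mathbb N\}=\mathbb N^2$; let $\lambda_i=\alpha_{\tau_1(i)}$, $\rho_i=q_{\tau_2(i)}$, $I_i=B(\lambda_i,\rho_i)$ (open ball). Fix computable $\sigma:\mathbb N^2\to\mathbb N$, $\eta:\mathbb N\to\mathbb N$ such that $\{(\sigma(j,0),\dots,\sigma(j,\eta(j))):j\in\mathbb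 N\}$ is the set of all nonempty finite sequences in $\mathbb N$; let $[j]=\{\sigma(j,i):0\le i\le\eta(j)\}$, $J_j=\bigcup_{i\in[j]}I_i$ and $\Lambda_j=\{\alpha_i:i\in[j]\}$. A set $K\subseteq X$ is a semi-computable compact set if $K$ is compact in $(X,d)$ and $\{j\in\mathbb N: K\subseteq J_j\}$ is computably enumerable. For $A,B\subseteq X$ and $\varepsilon>0$ write $A\prec_\varepsilon B$ if for each $a\in A$ there is $b\in B$ with $d(a,b)<\varepsilon$. For $A\subseteq B\subseteq X$, $A$ is computable up to $B$ if there is a computable $f:\mathbb N\to\mathbb N$ with $A\prec_{2^{-k}}\Lambda_{f(k)}$ and $\Lambda_{f(k)}\prec_{2^{-k}}B$ for all $k$. A neighborhood of $x$ in $S$ is a subset of $S$ containing $x$ in its interior relative to $S$. *)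

(* Defs.v *)
From Stdlib Require Import Reals Lra QArith Qreals List.
Open Scope R_scope.
Import ListNotations.

Inductive code : Type :=
| CZero : code
| CSucc : code
| CProj : nat -> code
| CComp : code -> list code -> code
| CPrec : code -> code -> code
| CMu   : code -> code.

Inductive eval : code -> list nat -> nat -> Prop :=
| ev_zero v : eval CZero v 0
| ev_succ x v : eval CSucc (x :: v) (S x)
| ev_proj i v : (i < length v)%nat -> eval (CProj i) v (nth i v 0%nat)
| ev_comp f gs v ys y : evals gs v ys -> eval f ys y -> eval (CComp f gs) v y
| ev_prec0 f g v y : eval f v y -> eval (CPrec f g) (0%nat :: v) y
| ev_precS f g n v r y :
    eval (CPrec f g) (n :: v) r -> eval g (n :: r :: v) y ->
    eval (CPrec f g) (S n :: v) y
| ev_mu f v n :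
    eval f (n :: v) 0%nat ->
    (forall m, (m < n)%nat -> exists k, eval f (m :: v) (S k)) ->
    eval (CMu f) v n
with evals : list code -> list nat -> list nat -> Prop :=
| evs_nil v : evals nil v nil
| evs_cons g gs v y ys : eval g v y -> evals gs v ys -> evals (g :: gs) v (y :: ys).

Definition comp_fun (k : nat) (f : list nat -> nat) : Prop :=
  exists c, forall v, length v = k -> eval c v (f v).

Definition comp1 (f : nat -> nat) : Prop := comp_fun 1 (fun v => f (nth 0 v 0%nat)).
Definition comp2 (f : nat -> nat -> nat) : Prop :=
  comp_fun 2 (fun v => f (nth 0 v 0%nat) (nth 1 v 0%nat)).

(** A computable function G : N^(k+1) -> Q, encoded as (a - b)/(c + 1). *)
Definition rat_of (a b c : nat) : R := (INR a - INR b) / INR (S c).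

Definition comp_real_fun (k : nat) (g : list nat -> R) : Prop :=
  exists a b c : list nat -> nat,
    comp_fun (S k) a /\ comp_fun (S k) b /\ comp_fun (S k) c /\
    forall v i, length v = k ->
      Rabs (g v - rat_of (a (v ++ [i])) (b (v ++ [i])) (c (v ++ [i]))) < (/2) ^ i.

Definition comp_Q_seq (q : nat -> Q) : Prop :=
  exists a b c : nat -> nat, comp1 a /\ comp1 b /\ comp1 c /\
    forall i, Q2R (q i) = rat_of (a i) (b i) (c i).

Definition ce (A : nat -> Prop) : Prop :=
  exists c, forall j, A j <-> exists y, eval c [j] y.

Definition is_metric {X : Type} (d : X -> X -> R) : Prop :=
  (forall x y, 0 <= d x y) /\
  (forall x y, d x y = 0 <-> x = y) /\
  (forall x y, d x y = d y x) /\
  (forall x y z, d x z <= d x y + d y z).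

Definition open_set {X : Type} (d : X -> X -> R) (U : X -> Prop) : Prop :=
  forall x, U x -> exists r, 0 < r /\ forall y, d x y < r -> U y.

Definition compact {X : Type} (d : X -> X -> R) (K : X -> Prop) : Prop :=
  forall (I : Type) (V : I -> X -> Prop),
    (forall i, open_set d (V i)) ->
    (forall x, K x -> exists i, V i x) ->
    exists l : list I, forall x, K x -> exists i, In i l /\ V i x.

Definition computable_metric_space {X : Type} (d : X -> X -> R) (alpha : nat -> X) : Prop :=
  is_metric d /\
  (forall x eps, 0 < eps -> exists i, d x (alpha i) < eps) /\
  comp_real_fun 2 (fun v => d (alpha (nth 0 v 0%nat)) (alpha (nth 1 v 0%nat))).

Definition enum_data (q : nat -> Q) (tau1 tau2 : nat -> nat)
    (sigma : nat -> nat -> nat) (eta : nat -> nat) : Prop :=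
  comp_Q_seq q /\ (forall i, (0 < q i)%Q) /\ (forall r, (0 < r)%Q -> exists i, q i == r) /\
  comp1 tau1 /\ comp1 tau2 /\
  (forall a b, exists i, tau1 i = a /\ tau2 i = b) /\
  comp2 sigma /\ comp1 eta /\
  (forall s : list nat, s <> nil ->
     exists j, length s = S (eta j) /\ forall i, (i <= eta j)%nat -> sigma j i = nth i s 0%nat).

Definition sub_J {X : Type} (d : X -> X -> R) (alpha : nat -> X) (q : nat -> Q)
    (tau1 tau2 : nat -> nat) (sigma : nat -> nat -> nat) (eta : nat -> nat)
    (K : X -> Prop) (j : nat) : Prop :=
  forall x, K x -> exists i, (i <= eta j)%nat /\
     d x (alpha (tau1 (sigma j i))) < Q2R (q (tau2 (sigma j i))).

Definition semi_computable_compact {X : Type} (d : X -> X -> R) (alpha : nat -> X)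
    (q : nat -> Q) (tau1 tau2 : nat -> nat) (sigma : nat -> nat -> nat) (eta : nat -> nat)
    (K : X -> Prop) : Prop :=
  compact d K /\ ce (sub_J d alpha q tau1 tau2 sigma eta K).

Definition Lambda {X : Type} (alpha : nat -> X) (sigma : nat -> nat -> nat) (eta : nat -> nat)
    (j : nat) (y : X) : Prop :=
  exists i, (i <= eta j)%nat /\ y = alpha (sigma j i).

Definition prec {X : Type} (d : X -> X -> R) (eps : R) (A B : X -> Prop) : Prop :=
  forall a, A a -> exists b, B b /\ d a b < eps.

Definition computable_up_to {X : Type} (d : X -> X -> R) (alpha : nat -> X)
    (sigma : nat -> nat -> nat) (eta : nat -> nat) (A B : X -> Prop) : Prop :=
  exists f : nat -> nat, comp1 f /\ forall k,
    prec d ((/2) ^ k) A (Lambda alpha sigma eta (f k)) /\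
    prec d ((/2) ^ k) (Lambda alpha sigma eta (f k)) B.

Definition nbhd_in {X : Type} (d : X -> X -> R) (S N : X -> Prop) (x : X) : Prop :=
  (forall y, N y -> S y) /\ S x /\ N x /\
  exists r, 0 < r /\ forall y, S y -> d x y < r -> N y.

Fixpoint sumR (n : nat) (f : nat -> R) : R :=
  match n with O => 0 | S m => sumR m f + f m end.

Definition eucl (n : nat) (p p' : nat -> R) : R :=
  sqrt (sumR n (fun i => (p i - p' i) ^ 2)).

Definition in_Rn (n : nat) (p : nat -> R) : Prop := forall i, (n <= i)%nat -> p i = 0.
Definition in_H (n : nat) (p : nat -> R) : Prop := in_Rn n p /\ 0 <= p (pred n).
Definition in_BdH (n : nat) (p : nat -> R) : Prop := in_Rn n p /\ p (pred n) = 0.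

Definition homeo_H {X : Type} (d : X -> X -> R) (n : nat) (f : (nat -> R) -> X)
    (U : X -> Prop) : Prop :=
  (forall p, in_H n p -> U (f p)) /\
  (forall y, U y -> exists p, in_H n p /\ f p = y) /\
  (forall p p', in_H n p -> in_H n p' -> f p = f p' -> p = p') /\
  (forall p eps, in_H n p -> 0 < eps -> exists delta, 0 < delta /\
     forall p', in_H n p' -> eucl n p p' < delta -> d (f p) (f p') < eps) /\
  (forall p eps, in_H n p -> 0 < eps -> exists delta, 0 < delta /\
     forall p', in_H n p' -> d (f p) (f p') < delta -> eucl n p p' < eps).

Definition maps_boundary_onto {X : Type} (n : nat) (f : (nat -> R) -> X)
    (U T : X -> Prop) : Prop :=
  (forall p, in_BdH n p -> U (f p) /\ T (f p)) /\
  (forall y, U y -> T y -> exists p, in_BdH n p /\ f p = y).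

(* Main.v *)
(** A ball I meets S as soon as S is covered by I, by pairs of formally disjoint finite unions of rational balls U_c, V_c (c < n) separating the opposite faces of a cell of the chart, and by a fixed finite family of balls away from that cell: if I missed S, then U_c and V_c would cover the cell, contradicting the Lebesgue covering theorem. The bottom face lies in T, so that V_{n-1} misses it is verified through an enumeration of the covers of T; for the other faces fixed finite covers suffice. Such certificates are computably enumerable, and by compactness every ball containing a point of S close to x has one. A search for covers of S by small balls that are certified or far from x then yields the approximating sets. *)

(* Covers of a compact set bound it only from outside; that a ball does meet [S] has to be forced by
   topology, and whatever is checked on the way must be semidecidable. This is why disjointness of
   balls is replaced by formal disjointness, a strict inequality between computable reals. The chart
   carries no computability: only finite data derived from it enter the search, namely the lists
   [w], [lo], [hi] and the ball [z]. Three concentric cells of radius e, 2e, 3e about the preimage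
   of [x] are used. Points to be certified lie in the first, the opposite faces of the second are
   separated, and the third catches all of [S] that [w] leaves uncovered. The margin e keeps
   certified points at a positive distance from the faces, so one fixed cover of a face serves every
   certificate. The obstacle is the bottom face when [x] lies in [T]: certified points then come
   arbitrarily close to it and no fixed cover is fine enough, so every certificate carries its own
   cover of [T]. *)
Require Import Defs.
From Stdlib Require Import Reals QArith Qreals List.
From Stdlib Require Import Lra Lia Arith Classical ClassicalEpsilon.
From Coquelicot Require Import Rcomplements Compactness.
From mathcomp Require all_boot.
Open Scope R_scope.

(** * A mod 2 discrete Poincare-Miranda theorem *)

Module CubeParity.
Import all_boot.
Local Open Scope nat_scope.

Section Grid.
Variables (n m : nat).
Implicit Types (D : {set 'I_n}) (a b c : 'I_n).
Local Notation V := {ffun 'I_n -> 'I_m.+1}.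
Implicit Types (v w : V).
Local Notation "\xor_ ( i | P ) F" := (\big[addb/false]_(i | P) F) (at level 41, i at level 50).
Local Notation "\xor_ ( i 'in' A ) F" := (\big[addb/false]_(i in A) F) (at level 41, i, A at level 50).

(** The step wraps around at [ord_max], which makes it a bijection along which sums can be
    reindexed; the cells that would wrap are excluded by conditions [v b != ord_max]. *)
Definition shift a v : V := [ffun i => if i == a then ordS (v i) else v i].

Lemma shiftC a b v : shift a (shift b v) = shift b (shift a v).
Proof. by apply/ffunP => i; rewrite !ffunE; case: (i == a); case: (i == b). Qed.

Lemma shift_bij a : bijective (shift a).
Proof.
exists (fun v => [ffun i => if i == a then ord_pred (v i) else v i]) => v;
  by apply/ffunP => i; rewrite !ffunE; case: eqP => // _; rewrite ?ordSK ?ord_predK.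
Qed.

(* Distinct ordered pairs come in twos. *)
Lemma xor_symm_pairs D (G : 'I_n -> 'I_n -> bool) :
  (forall a b, G a b = G b a) ->
  \xor_(a in D) (\xor_(b in D :\ a) G a b) = false.
Proof.
move=> symG.
have E (a : 'I_n) : \xor_(b in D :\ a) G a b =
   (\xor_(b | (b \in D) && (b < a)) G a b) (+) (\xor_(b | (b \in D) && (a < b)) G a b).
  rewrite (bigID (fun b : 'I_n => b < a)) /=; congr (_ (+) _); apply: eq_bigl => b;
    rewrite in_setD1 -(inj_eq val_inj) /=; case: ltngtP; rewrite ?andbT ?andbF //=.
under eq_bigr => a _ do rewrite E.
rewrite big_split /= [X in X (+) _](exchange_big_dep (mem D)) /=; last by move=> a b _ /andP[].
set x := (X in X (+) _); set y := (X in _ (+) X).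
have -> : x = y.
  apply: eq_bigr => a aD; apply: eq_big => [b|b _]; last exact: symG.
  by rewrite aD /=.
exact: addbb.
Qed.

Variable s : nat -> V -> bool.

(* The cup product of the coboundaries of s_j, ..., s_{j+k-1} over F_2, on the cell with lowest vertex v and directions D: the sum over all monotone edge paths of the products of the increments. *)
Fixpoint cup j k D v : bool :=
  if k is k'.+1 then
    \xor_(b in D) ((s j (shift b v) (+) s j v) && cup j.+1 k' (D :\ b) (shift b v))
  else true.

(** A cup product of coboundaries is a cocycle. After the induction hypothesis has been applied, a
    sum of a symmetric term over ordered pairs of distinct directions remains, and it vanishes
    modulo 2. *)
Lemma cup_closed k j D v :
  \xor_(a in D) (cup j k (D :\ a) (shift a v) (+) cup j k (D :\ a) v) = false.
Proof.
elim: k j D v => [|k IH] j D v /=; first by rewrite big1.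
set T := fun a b w => cup j.+1 k (D :\ a :\ b) w.
have TC a b w : T a b w = T b a w by rewrite /T setDDl setUC -setDDl.
have IHs a w : \xor_(b in D :\ a) T a b (shift b w) = \xor_(b in D :\ a) T a b w.
  move: (IH j.+1 (D :\ a) w); rewrite big_split /= => /negbT.
  by rewrite negb_add => /eqP.
(* The induction hypothesis moves each factor [T a b] to the vertex at which its partner [s j] is
   evaluated; this leaves one term for each vertex of the square spanned by [a] and [b]. *)
pose G a b := (s j (shift a (shift b v)) && T a b (shift a (shift b v)))
  (+) ((s j (shift a v) && T a b (shift a v)) (+) (s j (shift b v) && T a b (shift b v)))
  (+) (s j v && T a b v).
have symG a b : G a b = G b a.
  rewrite /G (shiftC a b) !(TC a b) [in LHS](addbC (s j (shift a v) && _)).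
  by [].
rewrite -[RHS](xor_symm_pairs D G symG).
apply: eq_bigr => a _.
have e1 : \xor_(b in D :\ a) (s j (shift a v) && T a b (shift b (shift a v))) =
          \xor_(b in D :\ a) (s j (shift a v) && T a b (shift a v)).
  by rewrite -!big_distrr /= IHs.
have e2 : \xor_(b in D :\ a) (s j v && T a b (shift b v)) =
          \xor_(b in D :\ a) (s j v && T a b v).
  by rewrite -!big_distrr /= IHs.
rewrite /G !big_split /= -e1 -e2 -!big_split /=.
apply: eq_bigr => b _; rewrite (shiftC a b) -/(T a b _) -/(T a b _).
move: (s j _) (s j (shift a v)) (s j (shift b v)) (s j v) (T a b _) (T a b (shift a v)) (T a b (shift b v)) (T a b v).
by do 8!case.
Qed.

(** Every path contributes a product containing an increment of [s b], and no path with directions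
    in [D] leaves the hyperplane on which [s b] is constant. *)
Lemma cup_const b k j D v :
  j <= b < j + k -> b \notin D -> (forall w, w b = v b -> s b w = s b v) -> cup j k D v = false.
Proof.
elim: k j D v => [|k IH] j D v /andP[jb bk] bD sb /=; first by rewrite addn0 ltnNge jb in bk.
rewrite big1 // => c cD.
have ncb : b != c by apply: contraNneq bD => ->.
have vb : shift c v b = v b by rewrite ffunE (negbTE ncb).
case: (eqVneq (b : nat) j) => [<-|bj]; first by rewrite sb // addbb.
rewrite IH ?andbF //.
- by rewrite ltn_neqAle eq_sym bj jb addSnnS.
- by rewrite in_setD1 (negbTE bD) andbF.
by move=> w; rewrite vb => /sb ->; rewrite sb.
Qed.

Hypothesis s0 : forall a v, v a = ord0 -> s a v = false.
Hypothesis s1 : forall a v, v a = ord_max -> s a v = true.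

(** Telescoping along the lines in direction [b]: modulo 2 only their two ends survive. *)
Lemma xor_shift b (P : pred V) (h : V -> bool) :
  (forall v w, (forall a, a != b -> v a = w a) -> P v = P w) ->
  \xor_(v | P v && (v b != ord_max)) (h (shift b v) (+) h v) =
  (\xor_(v | P v && (v b == ord0)) h v) (+) (\xor_(v | P v && (v b == ord_max)) h v).
Proof.
move=> Pb; rewrite big_split /=.
have -> : \xor_(v | P v && (v b != ord_max)) h (shift b v) = \xor_(v | P v && (v b != ord0)) h v.
  rewrite [RHS](reindex (shift b)) /=; last exact: onW_bij (shift_bij b).
  apply: eq_bigl => v; congr (_ && ~~ _).
    by apply: Pb => a ab; rewrite ffunE (negbTE ab).
  rewrite ffunE eqxx -!(inj_eq val_inj) /=.
  have := ltn_ord (v b); rewrite ltnS leq_eqVlt => /orP[/eqP ->|lt]; first by rewrite modnn !eqxx.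
  by rewrite modn_small ?ltnS // (ltn_eqF lt).
have split (Q : pred V) :
    \xor_(v | P v && ~~ Q v) h v = (\xor_(v | P v) h v) (+) (\xor_(v | P v && Q v) h v).
  by rewrite [X in X (+) _](bigID Q) /= addbAC addbb addFb.
rewrite (split (fun v => v b == ord0)) (split (fun v => v b == ord_max)).
by rewrite addbACA addbb addFb.
Qed.

(** These are the lowest vertices of the cells that tile the face where the first [j] coordinates
    are maximal. *)
Definition face j v := [forall i : 'I_n, if i < j then v i == ord_max else v i != ord_max].

(** Stokes' theorem modulo 2. By [cup_closed] the summand is the coboundary of [s j] times the
    remaining cup product, so the total telescopes to the facets. Those in a direction above [j]
    vanish by [cup_const]; in direction [j] the lower one vanishes since [s j] is false there, and
    the upper one, where [s j] is true, is the next face. *)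
Lemma cup_face j : j <= n ->
  \xor_(v | face j v) cup j (n - j) [set i : 'I_n | j <= i] v = true.
Proof.
move=> jn; have [k nj] : exists k, n - j = k by exists (n - j).
elim: k j jn nj => [|k IH] j jn nj.
  have {nj} -> : j = n by apply/eqP; rewrite eqn_leq jn -subn_eq0 nj.
  rewrite subnn /= (big_pred1 [ffun=> ord_max]) // => v.
  apply/forallP/eqP => [fv|-> i]; last by rewrite ltn_ord ffunE.
  by apply/ffunP => i; have := fv i; rewrite ltn_ord ffunE => /eqP.
have ltjn : j < n by rewrite -subn_gt0 nj.
have nj' : n - j.+1 = k by rewrite subnS nj.
set D := [set i : 'I_n | j <= i].
pose h b w := s j w && cup j.+1 k (D :\ b) w.
transitivity (\xor_(b in D) (\xor_(v | face j v) (h b (shift b v) (+) h b v))).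
  rewrite exchange_big /=; apply: eq_bigr => v _; rewrite nj /=.
  have C := cup_closed k j.+1 D v.
  have e : \xor_(b in D) (s j v && cup j.+1 k (D :\ b) (shift b v)) = \xor_(b in D) h b v.
    rewrite -!big_distrr /=; congr (_ && _); apply/eqP; rewrite -negb_add.
    by rewrite -big_split /= C.
  rewrite [RHS]big_split /= -e -big_split /=; apply: eq_bigr => b _.
  by rewrite /h andb_addl.
pose a0 := Ordinal ltjn.
have a0D : a0 \in D by rewrite inE.
have E b : b \in D -> \xor_(v | face j v) (h b (shift b v) (+) h b v) = (b == a0).
  rewrite inE => jb.
  pose P v := [forall i : 'I_n, (i != b) ==> if i < j then v i == ord_max else v i != ord_max].
  have faceE v : face j v = P v && (v b != ord_max).
    apply/forallP/andP => [fv|[/forallP Pv vb] i].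
      by split; [apply/forallP => i; apply/implyP => _; exact: fv | have := fv b; rewrite ltnNge jb].
    by case: (eqVneq i b) => [->|ib]; [rewrite ltnNge jb | have := Pv i; rewrite ib].
  rewrite (eq_bigl _ _ faceE) xor_shift; last first.
    move=> v w vw; apply: eq_forallb => i; case: (eqVneq i b) => //= ib.
    by rewrite vw.
  case: eqP => [eb|/eqP ba0]; last first.
    have jb' : j < b.
      by rewrite ltn_neqAle jb andbT; apply: contraNneq ba0 => jb'; apply/eqP/val_inj.
    have bk : j < b < j.+1 + k by rewrite jb' -nj' subnKC ?ltn_ord.
    have bD : b \notin D :\ b by rewrite in_setD1 eqxx.
    have h0 v : v b = ord0 \/ v b = ord_max -> h b v = false.
      move=> vb; rewrite /h (cup_const b) ?andbF // => w wv.
      by case: vb => vb; [rewrite !s0 // wv | rewrite !s1 // wv].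
    rewrite !big1 // => v /andP[_ /eqP vb]; apply: h0; [by right | by left].
  subst b; rewrite big1 => [|v /andP[_ /eqP v0]]; last by rewrite /h -[j]/(val a0) s0.
  rewrite addFb -(IH j.+1 ltjn nj') nj'; apply: eq_big => [v|v /andP[_ /eqP v1]].
    apply/andP/forallP => [[/forallP Pv vb] i|fv].
      case: (eqVneq i a0) => [->|ib]; first by rewrite leqnn vb.
      have := Pv i; rewrite ib /= ltnS [i <= j]leq_eqVlt.
      by rewrite -[(i : nat) == j]/(i == a0) (negbTE ib).
    split; last by have := fv a0; rewrite leqnn.
    apply/forallP => i; apply/implyP => ib; have := fv i.
    by rewrite ltnS [i <= j]leq_eqVlt -[(i : nat) == j]/(i == a0) (negbTE ib).
  have s1v : s j v = true by exact: (s1 a0).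
  rewrite /h s1v /=; congr (cup _ _ _ _).
  by apply/setP => i; rewrite !inE ltn_neqAle -(inj_eq val_inj) /= eq_sym.
rewrite (eq_bigr _ E) (bigD1 a0) //= eqxx big1 ?addbF // => b /andP[_ /negbTE].
by [].
Qed.

(** A nonzero summand is a monotone path in the cell along which each [s i] jumps at one step. The
    strengthened claim records that only directions in [D] move, so no coordinate advances twice. *)
Lemma cup_path k j D v :
  cup j k D v -> forall i, j <= i < j + k ->
  exists w w', [/\ s i w != s i w', forall c, w c = v c \/ w c = ordS (v c) & forall c, w' c = v c \/ w' c = ordS (v c)].
Proof.
suff H : cup j k D v -> forall i, j <= i < j + k -> exists w w',
   [/\ s i w != s i w', forall c, w c = v c \/ c \in D /\ w c = ordS (v c) & forall c, w' c = v c \/ c \in D /\ w' c = ordS (v c)].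
  move=> cv i ji; have [w [w' [ww' vw vw']]] := H cv i ji; exists w, w'; split=> // c.
    by case: (vw c) => [|[]]; [left | right].
  by case: (vw' c) => [|[]]; [left | right].
elim: k j D v => [|k IH] j D v /=.
  by move=> _ i; rewrite addn0 => /andP[ji]; rewrite ltnNge ji.
move=> cv i /andP[ji ijk].
have [b bD] : exists2 b, b \in D & (s j (shift b v) (+) s j v) && cup j.+1 k (D :\ b) (shift b v).
  apply/exists_inP; apply: contraTT cv; rewrite negb_exists_in => /forall_inP nb.
  by rewrite big1 // => b bD; apply/negbTE/nb.
move=> /andP[sb cb].
have vS c : shift b v c = v c \/ c \in D /\ shift b v c = ordS (v c).
  by rewrite ffunE; case: eqP => [->|]; [right | left].
case: (eqVneq i j) => [->|ij].
  by exists (shift b v), v; split=> [|//|c]; [rewrite -negb_add negbK in sb * | left].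
have ji' : j < i < j.+1 + k by rewrite ltn_neqAle eq_sym ij ji addSnnS.
have [w [w' [ww' vw vw']]] := IH _ _ _ cb i ji'.
have vSD w0 c : w0 c = shift b v c \/ c \in D :\ b /\ w0 c = ordS (shift b v c) ->
    w0 c = v c \/ c \in D /\ w0 c = ordS (v c).
  by case=> [->//|]; rewrite in_setD1 ffunE => -[/andP[/negbTE-> cD] ->]; right.
by exists w, w'; split=> // c; apply: vSD.
Qed.

Lemma cell_all_vary : exists v : V, (forall c, v c != ord_max) /\
  forall i, i < n -> exists w w', [/\ s i w != s i w',
    forall c, w c = v c \/ w c = ordS (v c) & forall c, w' c = v c \/ w' c = ordS (v c)].
Proof.
have := cup_face 0 (leq0n n); rewrite subn0 => cf.
have [v fv cv] : exists2 v, face 0 v & cup 0 n [set i : 'I_n | 0 <= i] v.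
  apply/exists_inP; apply: contraTT cf; rewrite negb_exists_in => /forall_inP nb.
  by rewrite big1 // => v fv; apply/negbTE/nb.
exists v; split=> [c|i lt_in]; first by have /forallP/(_ c) := fv.
exact: (cup_path n 0 _ v cv).
Qed.
End Grid.

Lemma grid_cell_all_vary (n m : nat) (s : nat -> (nat -> nat) -> bool) :
  (forall i w, (i < n)%coq_nat -> w i = 0 -> s i w = false) ->
  (forall i w, (i < n)%coq_nat -> w i = m -> s i w = true) ->
  exists v : nat -> nat, (forall c, (c < n)%coq_nat -> (v c < m)%coq_nat) /\
    forall i, (i < n)%coq_nat -> exists w w' : nat -> nat,
     (forall c, (c < n)%coq_nat -> w c = v c \/ w c = (v c).+1) /\
     (forall c, (c < n)%coq_nat -> w' c = v c \/ w' c = (v c).+1) /\ s i w <> s i w'.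
Proof.
move=> s0 s1.
pose ext (v : {ffun 'I_n -> 'I_m.+1}) (c : nat) : nat := if insub c is Some o then val (v o) else 0.
have extE v (c : 'I_n) : ext v c = v c by rewrite /ext valK.
have [a v va|a v va|v [vm H]] := @cell_all_vary n m (fun i v => s i (ext v)).
- by apply: s0; [apply/ltP/ltn_ord | rewrite extE va].
- by apply: s1; [apply/ltP/ltn_ord | rewrite extE va].
have vm' (c : 'I_n) : v c < m.
  by have := ltn_ord (v c); rewrite ltnS leq_eqVlt (inj_eq val_inj (v c) ord_max) (negbTE (vm c)).
exists (ext v); split=> [c /ltP cn|i /ltP lt_in].
  by rewrite (extE v (Ordinal cn)); apply/ltP/vm'.
have [w [w' [ww' vw vw']]] := H i lt_in.
have step (w0 : {ffun 'I_n -> 'I_m.+1}) : (forall c, w0 c = v c \/ w0 c = ordS (v c)) ->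
    forall c, (c < n)%coq_nat -> ext w0 c = ext v c \/ ext w0 c = (ext v c).+1.
  move=> vw0 c /ltP cn; rewrite (extE w0 (Ordinal cn)) (extE v (Ordinal cn)).
  (* Since [v c < m], the cyclic successor is the ordinary one. *)
  by case: (vw0 (Ordinal cn)) => ->; [left | right; rewrite /= modn_small // ltnS].
by exists (ext w), (ext w'); do !split; [exact: step | exact: step | apply/eqP].
Qed.
End CubeParity.

Import ListNotations.

(** * Separation of opposite faces of a box *)

Lemma choice {A B : Type} (P : A -> B -> Prop) :
  (forall a, exists b, P a b) -> exists h, forall a, P a (h a).
Proof.
  intros H. exists (fun a => proj1_sig (constructive_indefinite_description _ (H a))).
  intros a. apply proj2_sig.
Qed.

Lemma sumR_nonneg n f : (forall i, (i < n)%nat -> 0 <= f i) -> 0 <= sumR n f.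
Proof.
  induction n as [|n IH]; intros H; simpl; [lra|].
  assert (0 <= f n) by auto. assert (0 <= sumR n f) by auto. lra.
Qed.

Lemma sumR_term n f i : (forall i, 0 <= f i) -> (i < n)%nat -> f i <= sumR n f.
Proof.
  intros H. induction n as [|n IH]; intros L; [lia|]. simpl.
  assert (0 <= sumR n f) by (apply sumR_nonneg; auto). specialize (H n).
  destruct (Nat.eq_dec i n) as [->|]; [lra|]. specialize (IH ltac:(lia)). lra.
Qed.

Lemma sumR_le n f a : (forall i, (i < n)%nat -> f i <= a) -> sumR n f <= INR n * a.
Proof.
  induction n as [|n IH]; intros H; [simpl; lra|]. rewrite S_INR. simpl.
  specialize (IH ltac:(auto)). specialize (H n ltac:(lia)). lra.
Qed.

Lemma eucl_coord n p p' i : (i < n)%nat -> Rabs (p i - p' i) <= eucl n p p'.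
Proof.
  intros L. unfold eucl. rewrite <- sqrt_Rsqr_abs. apply sqrt_le_1_alt.
  rewrite Rsqr_pow2. apply (sumR_term n (fun i => (p i - p' i) ^ 2)); auto.
  intros. apply pow2_ge_0.
Qed.

Lemma eucl_le n p p' a :
  0 <= a -> (forall i, (i < n)%nat -> Rabs (p i - p' i) <= a) -> eucl n p p' <= INR n * a.
Proof.
  intros A H. unfold eucl.
  assert (N : 0 <= INR n) by apply pos_INR.
  rewrite <- (sqrt_pow2 (INR n * a)) by nra. apply sqrt_le_1_alt.
  apply Rle_trans with (INR n * a ^ 2).
  - apply sumR_le. intros i L. rewrite <- (pow2_abs (p i - p' i)).
    apply pow_incr. split; [apply Rabs_pos|auto].
  - destruct n as [|n]; [simpl; lra|]. rewrite S_INR in *. assert (0 <= INR n) by apply pos_INR.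
    assert (0 <= INR n * (a ^ 2)) by (apply Rmult_le_pos; auto; apply pow2_ge_0).
    assert (0 <= INR n * (INR n * (a ^ 2))) by (apply Rmult_le_pos; auto).
    nra.
Qed.

(** The existence of a Lebesgue number: the gauge [delta] has a uniform lower bound on the interval,
    to which monotonicity of [Q] descends. *)
Lemma interval_uniform a b (Q : R -> R -> Prop) :
  (forall s e e', Q s e -> 0 < e' <= e -> Q s e') ->
  (forall s, a <= s <= b -> exists e, 0 < e /\ forall s', a <= s' <= b -> Rabs (s' - s) < e -> Q s' e) ->
  exists e, 0 < e /\ forall s, a <= s <= b -> Q s e.
Proof.
  intros M H.
  assert (E : forall s, exists e : posreal, a <= s <= b ->
    forall s', a <= s' <= b -> Rabs (s' - s) < e -> Q s' e).
  { intros s. destruct (classic (a <= s <= b)) as [I|I].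
    - destruct (H s I) as [e [P He]]. exists (mkposreal e P). auto.
    - exists (mkposreal 1 Rlt_0_1). tauto. }
  apply choice in E. destruct E as [delta Hd].
  destruct (Compactness.compactness_value_1d a b delta) as [e He].
  exists e. split; [apply cond_pos|]. intros s I. apply NNPP. intros N.
  apply (He s I). intros [t [It [C L]]]. apply N.
  apply M with (delta t).
  - apply (Hd t It s I C).
  - split; [apply cond_pos|auto].
Qed.

Definition box (n : nat) (l u : nat -> R) (p : nat -> R) : Prop :=
  in_Rn n p /\ forall i, (i < n)%nat -> l i <= p i <= u i.

Definition near (n : nat) (e : R) (p p' : nat -> R) : Prop :=
  forall i, (i < n)%nat -> Rabs (p i - p' i) < e.

Lemma near_sym n e p p' : near n e p p' -> near n e p' p.
Proof. intros N i L. rewrite Rabs_minus_sym. auto. Qed.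

Lemma near_trans n e e' p p' p'' : near n e p p' -> near n e' p' p'' -> near n (e + e') p p''.
Proof.
  intros N N' i L. specialize (N i L). specialize (N' i L).
  replace (p i - p'' i) with ((p i - p' i) + (p' i - p'' i)) by ring.
  eapply Rle_lt_trans; [apply Rabs_triang|lra].
Qed.

Lemma near_le n e e' p p' : near n e p p' -> e <= e' -> near n e' p p'.
Proof. intros N L i Hi. specialize (N i Hi). lra. Qed.

(** Induction on the number [k] of coordinates in which [x] may be far from [p]; each step frees one
    more coordinate by the compactness of one interval. *)
Lemma box_uniform n l u (P : (nat -> R) -> R -> Prop) :
  (forall x e e', P x e -> 0 < e' <= e -> P x e') ->
  (forall t, box n l u t -> exists e, 0 < e /\ forall x, box n l u x -> near n e t x -> P x e) ->
  exists e, 0 < e /\ forall x, box n l u x -> P x e.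
Proof.
  intros M H.
  assert (K : forall k, (k <= n)%nat -> forall p, box n l u p -> exists e, 0 < e /\
    forall x, box n l u x -> (forall i, (k <= i < n)%nat -> Rabs (p i - x i) < e) -> P x e).
  { induction k as [|k IH]; intros Lk p Bp.
    - destruct (H p Bp) as [e [E He]]. exists e. split; auto. intros x Bx Nx.
      apply He; auto. intros i Li. apply Nx. lia.
    - destruct (interval_uniform (l k) (u k) (fun s e => forall x, box n l u x -> x k = s ->
        (forall i, (S k <= i < n)%nat -> Rabs (p i - x i) < e) -> P x e)) as [e [E He]].
      + intros s e e' Hs Le x Bx Ex Nx. apply M with e; auto. apply Hs; auto.
        intros i Li. specialize (Nx i Li). lra.
      + intros s Is.
        destruct (IH ltac:(lia) (fun i => if Nat.eq_dec i k then s else p i)) as [e [E He]].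
        { split.
          - intros i Li. destruct (Nat.eq_dec i k); [lia|]. apply Bp; auto.
          - intros i Li. destruct (Nat.eq_dec i k); [subst; auto|]. apply Bp; auto. }
        exists e. split; auto. intros s' Is' Ns x Bx Ex Nx. apply He; auto.
        intros i Li. destruct (Nat.eq_dec i k) as [->|].
        * rewrite Ex, Rabs_minus_sym. auto.
        * apply Nx. lia.
      + exists e. split; auto. intros x Bx Nx. apply (He (x k)); auto. apply Bx. lia. }
  destruct (classic (exists p, box n l u p)) as [[p Bp]|N].
  - destruct (K n (le_n n) p Bp) as [e [E He]]. exists e. split; auto.
    intros x Bx. apply He; auto. lia.
  - exists 1. split; [lra|]. intros x Bx. exfalso. eauto.
Qed.

(* Lebesgue's covering theorem for the cube, with F c true in the role of U_c and F c false in that of V_c. *)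
Lemma box_not_separated n l u (F : nat -> bool -> (nat -> R) -> Prop) :
  (forall i, (i < n)%nat -> l i < u i) ->
  (forall t, box n l u t -> exists c b e, (c < n)%nat /\ 0 < e /\
     forall x, box n l u x -> near n e t x -> F c b x) ->
  (forall c x, (c < n)%nat -> box n l u x -> F c true x -> F c false x -> False) ->
  (forall c x, (c < n)%nat -> box n l u x -> x c = l c -> F c false x -> False) ->
  (forall c x, (c < n)%nat -> box n l u x -> x c = u c -> F c true x -> False) -> False.
Proof.
  intros LU Cov Dis Low Upp.
  destruct (box_uniform n l u (fun x e => exists c b, (c < n)%nat /\
    forall x', box n l u x' -> near n e x x' -> F c b x')) as [e [E He]].
  - intros x e e' [c [b [Lc Hc]]] Le. exists c, b. split; auto.
    intros x' Bx' N. apply Hc; auto. apply near_le with e'; auto. lra.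
  - intros t Bt. destruct (Cov t Bt) as [c [b [e [Lc [E He]]]]]. exists (e / 2). split; [lra|].
    intros x Bx N. exists c, b. split; auto. intros x' Bx' N'. apply He; auto.
    apply near_le with (e / 2 + e / 2); [|lra]. eapply near_trans; eauto.
  - set (M := sumR n (fun i => Rabs (u i - l i))).
    assert (HM : forall i, (i < n)%nat -> u i - l i <= M).
    { intros i Li. eapply Rle_trans; [apply Rle_abs|].
      apply (sumR_term n (fun i => Rabs (u i - l i))); auto. intros. apply Rabs_pos. }
    assert (M0 : 0 <= M) by (apply sumR_nonneg; intros; apply Rabs_pos).
    (* As [M] bounds every side length, cutting each side into [m] parts gives a mesh below [e]. *)
    destruct (INR_unbounded (M / e)) as [m Hm].
    assert (m0 : 0 < INR m).
    { apply Rle_lt_trans with (M / e); auto. apply Rmult_le_pos; auto.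
      apply Rlt_le, Rinv_0_lt_compat, E. }
    set (pt := fun (v : nat -> nat) i => if le_lt_dec n i then 0 else l i + (u i - l i) * (INR (v i) / INR m)).
    assert (Bpt : forall v, (forall i, (i < n)%nat -> (v i <= m)%nat) -> box n l u (pt v)).
    { intros v Hv. split; intros i Li; unfold pt; destruct (le_lt_dec n i); try lia; auto.
      assert (0 <= INR (v i) / INR m <= 1).
      { specialize (Hv i Li). apply le_INR in Hv. assert (P := pos_INR (v i)). split.
        - apply Rdiv_le_0_compat; auto.
        - apply Rle_div_l; lra. }
      specialize (LU i Li). nra. }
    (* The indicator of [F i false], forced to the values on opposite faces that the grid theorem
       demands. By [Low] and [Upp] the forcing changes nothing on a cell contained in a single
       [F c b], so [s c] is constant there. *)
    set (s := fun i v => if excluded_middle_informative (v i = m \/ (v i <> 0%nat /\ F i false (pt v)))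
       then true else false).
    destruct (CubeParity.grid_cell_all_vary n m s) as [v [Lv Hv]].
    + intros i w Li Z. unfold s. destruct (excluded_middle_informative _) as [[H|[H _]]|]; auto; try tauto.
      exfalso. rewrite H in Z. rewrite Z in m0. simpl in m0. lra.
    + intros i w Li Z. unfold s. destruct (excluded_middle_informative _); tauto.
    + assert (Bv : box n l u (pt v)).
      { apply Bpt. intros i Li. specialize (Lv i Li). lia. }
      destruct (He _ Bv) as [c [b [Lc Hc]]]. destruct (Hv c Lc) as [w [w' [W [W' D]]]].
      assert (K : forall w, (forall c, (c < n)%nat -> w c = v c \/ w c = S (v c)) ->
        s c w = negb b).
      { clear w w' W W' D. intros w W.
        assert (Bw : box n l u (pt w)).
        { apply Bpt. intros i Li. specialize (Lv i Li). destruct (W i Li); lia. }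
        assert (Fw : F c b (pt w)).
        { apply Hc; auto. intros i Li. unfold pt. destruct (le_lt_dec n i); [lia|].
          replace (l i + _ - _) with ((u i - l i) * ((INR (v i) - INR (w i)) / INR m)) by (field; lra).
          destruct (W i Li) as [->| ->].
          - replace (_ * _) with 0 by (field; lra). rewrite Rabs_R0. auto.
          - rewrite S_INR. replace (_ * _) with (- ((u i - l i) / INR m)) by (field; lra).
            specialize (LU i Li). specialize (HM i Li).
            rewrite Rabs_Ropp, Rabs_pos_eq.
            + apply Rlt_div_l in Hm; auto. apply Rlt_div_l; auto. lra.
            + apply Rdiv_le_0_compat; lra. }
        unfold s. destruct (excluded_middle_informative _) as [H|H]; destruct b; auto; exfalso.
        - destruct H as [H|[_ H]]; [|eauto]. apply (Upp c (pt w)); auto.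
          unfold pt. destruct (le_lt_dec n c); [lia|]. rewrite H. field. lra.
        - apply H. destruct (Nat.eq_dec (w c) m); auto. right. split; auto.
          intros Z. apply (Low c (pt w)); auto.
          unfold pt. destruct (le_lt_dec n c); [lia|]. rewrite Z. simpl. field. lra. }
      apply D. rewrite !K; auto.
Qed.

(** * Computable functions and Sigma_1 predicates *)

Section Computable.
Local Hint Extern 1 (lt _ _) => lia : core.
Local Open Scope nat_scope.

Lemma comp_fun_ext k f g :
  (forall v, length v = k -> f v = g v) -> comp_fun k f -> comp_fun k g.
Proof. intros E [c H]. exists c. intros v L. rewrite <- E; auto. Qed.

Lemma comp_fun_nth k i : i < k -> comp_fun k (fun v => nth i v 0).
Proof. intros L. exists (CProj i). intros v E. constructor. lia. Qed.

Lemma comp_fun_subst k f gs :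
  comp_fun (length gs) f -> Forall (comp_fun k) gs ->
  comp_fun k (fun v => f (map (fun g => g v) gs)).
Proof.
  intros [c Hc] F.
  assert (exists cs, forall v, length v = k -> evals cs v (map (fun g => g v) gs)) as [cs Hcs].
  { clear c Hc. induction F as [|g gs [c Hc] F [cs IH]].
    - exists nil. intros. constructor.
    - exists (c :: cs). intros. constructor; auto. }
  exists (CComp c cs). intros v L. econstructor.
  - apply Hcs; auto.
  - apply Hc. rewrite length_map. reflexivity.
Qed.

Lemma comp_fun_app1 k f g :
  comp1 f -> comp_fun k g -> comp_fun k (fun v => f (g v)).
Proof. intros F G. apply (comp_fun_subst k _ [g] F). auto. Qed.

Lemma comp_fun_app2 k f g h :
  comp2 f -> comp_fun k g -> comp_fun k h -> comp_fun k (fun v => f (g v) (h v)).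
Proof. intros F G H. apply (comp_fun_subst k _ [g; h] F). auto. Qed.

Lemma comp_fun_app3 k (f : list nat -> nat) g h l :
  comp_fun 3 f -> comp_fun k g -> comp_fun k h -> comp_fun k l ->
  comp_fun k (fun v => f [g v; h v; l v]).
Proof. intros F G H L. apply (comp_fun_subst k _ [g; h; l] F). auto. Qed.

Lemma comp1_S : comp1 S.
Proof. exists CSucc. intros [|x [|]] L; try discriminate. constructor. Qed.

Lemma comp_fun_const k c : comp_fun k (fun _ => c).
Proof.
  induction c as [|c IH].
  - exists CZero. constructor.
  - apply (comp_fun_app1 k S _ comp1_S IH).
Qed.

Lemma comp_fun_prec k f g :
  comp_fun k f -> comp_fun (S (S k)) g ->
  comp_fun (S k) (fun w => nat_rec (fun _ => nat) (f (tl w))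
    (fun n r => g (n :: r :: tl w)) (nth 0 w 0)).
Proof.
  intros [c Hc] [e He]. exists (CPrec c e). intros [|x v] L; [discriminate|].
  injection L as L. simpl. induction x as [|x IH]; simpl.
  - constructor. auto.
  - econstructor; [exact IH|]. apply He. simpl. lia.
Qed.

Lemma comp2_prec f g (h : nat -> nat -> nat) :
  comp1 f -> comp_fun 3 g -> (forall y, h 0 y = f y) ->
  (forall x y, h (S x) y = g [x; h x y; y]) -> comp2 h.
Proof.
  intros F G H0 HS.
  refine (comp_fun_ext _ _ _ _ (comp_fun_prec 1 _ g F G)).
  intros [|x [|y [|]]] L; try discriminate. simpl.
  induction x as [|x IH]; simpl; [rewrite H0|rewrite HS, IH]; reflexivity.
Qed.

Lemma comp1_id : comp1 (fun x => x).
Proof. apply comp_fun_nth. lia. Qed.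

Lemma comp2_add : comp2 Nat.add.
Proof.
  apply (comp2_prec (fun y => y) (fun w => S (nth 1 w 0))); auto using comp1_id.
  apply comp_fun_app1, comp_fun_nth; auto using comp1_S.
Qed.

Lemma comp2_mul : comp2 Nat.mul.
Proof.
  apply (comp2_prec (fun _ => 0) (fun w => nth 2 w 0 + nth 1 w 0)); auto.
  - apply (comp_fun_const 1 0).
  - apply comp_fun_app2; auto using comp2_add, comp_fun_nth.
Qed.

Lemma comp2_swap h : comp2 h -> comp2 (fun x y => h y x).
Proof. intros H. apply (comp_fun_app2 2 h); auto; apply comp_fun_nth; lia. Qed.

Lemma comp1_pred : comp1 Nat.pred.
Proof.
  assert (H : comp2 (fun x _ => Nat.pred x)).
  { apply (comp2_prec (fun _ => 0) (fun w => nth 0 w 0)); auto using comp_fun_nth.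
    apply (comp_fun_const 1 0). }
  exact (comp_fun_app2 1 _ _ _ H comp1_id comp1_id).
Qed.

Lemma comp2_sub : comp2 Nat.sub.
Proof.
  apply (comp2_swap (fun y x => x - y)).
  apply (comp2_prec (fun y => y) (fun w => Nat.pred (nth 1 w 0))); auto using comp1_id.
  - apply comp_fun_app1; auto using comp1_pred, comp_fun_nth.
  - intros. lia.
  - intros. simpl. lia.
Qed.

Lemma comp1_pow2 : comp1 (Nat.pow 2).
Proof.
  assert (H : comp2 (fun x _ => 2 ^ x)).
  { apply (comp2_prec (fun _ => 1) (fun w => nth 1 w 0 + (nth 1 w 0 + 0))); auto.
    - apply (comp_fun_const 1 1).
    - apply (comp_fun_app2 3 Nat.add); [apply comp2_add|apply comp_fun_nth; lia|].
      apply (comp_fun_app2 3 Nat.add); [apply comp2_add|apply comp_fun_nth; lia|apply comp_fun_const]. }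
  exact (comp_fun_app2 1 _ _ _ H comp1_id comp1_id).
Qed.

Lemma comp_fun_mu k f :
  comp_fun (S k) f -> (forall v, length v = k -> exists n, f (n :: v) = 0) ->
  exists g, comp_fun k g /\ forall v, length v = k -> f (g v :: v) = 0.
Proof.
  intros [c Hc] E.
  assert (M : forall v, exists n, length v = k ->
            f (n :: v) = 0 /\ forall i, i < n -> f (i :: v) <> 0).
  { intros v. destruct (Nat.eq_dec (length v) k) as [L|L]; [|exists 0; tauto].
    destruct (E v L) as [n Hn]. revert Hn. induction n as [n IH] using lt_wf_ind. intros Hn.
    destruct (classic (exists i, i < n /\ f (i :: v) = 0)) as [[i [Hi Z]]|N].
    - exact (IH i Hi Z).
    - exists n. intros _. split; auto. intros i Hi Z. apply N. eauto. }
  exists (fun v => proj1_sig (constructive_indefinite_description _ (M v))).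
  split.
  - exists (CMu c). intros v L.
    destruct (constructive_indefinite_description _ (M v)) as [n Hn]; simpl.
    destruct (Hn L) as [Z P]. constructor.
    + rewrite <- Z. apply Hc. simpl. lia.
    + intros i Hi. exists (pred (f (i :: v))).
      replace (S (pred (f (i :: v)))) with (f (i :: v)) by (specialize (P i Hi); lia).
      apply Hc. simpl. lia.
  - intros v L.
    destruct (constructive_indefinite_description _ (M v)) as [n Hn]; simpl.
    apply Hn, L.
Qed.

(** * Decidable and Sigma_1 predicates on argument lists *)

Definition dec (k : nat) (P : list nat -> Prop) : Prop :=
  exists g, comp_fun k g /\ forall v, length v = k -> (P v <-> g v = 0).

Lemma dec_ext k P Q :
  (forall v, length v = k -> (P v <-> Q v)) -> dec k P -> dec k Q.
Proof. intros E [g [G H]]. exists g. split; auto. intros v L. rewrite <- E, H; tauto. Qed.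

Lemma dec_le k f g : comp_fun k f -> comp_fun k g -> dec k (fun v => f v <= g v).
Proof.
  intros F G. exists (fun v => f v - g v). split.
  - apply comp_fun_app2; auto using comp2_sub.
  - intros. lia.
Qed.

Lemma dec_and k P Q : dec k P -> dec k Q -> dec k (fun v => P v /\ Q v).
Proof.
  intros [f [F HF]] [g [G HG]]. exists (fun v => f v + g v). split.
  - apply comp_fun_app2; auto using comp2_add.
  - intros. rewrite HF, HG; auto. lia.
Qed.

Lemma dec_or k P Q : dec k P -> dec k Q -> dec k (fun v => P v \/ Q v).
Proof.
  intros [f [F HF]] [g [G HG]]. exists (fun v => f v * g v). split.
  - apply comp_fun_app2; auto using comp2_mul.
  - intros. rewrite HF, HG; auto. lia.
Qed.

Lemma dec_not k P : dec k P -> dec k (fun v => ~ P v).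
Proof.
  intros [f [F HF]]. exists (fun v => 1 - f v). split.
  - apply comp_fun_app2; auto using comp2_sub, comp_fun_const.
  - intros. rewrite HF; auto. lia.
Qed.

Lemma dec_eq k f g : comp_fun k f -> comp_fun k g -> dec k (fun v => f v = g v).
Proof.
  intros F G. apply (dec_ext k (fun v => f v <= g v /\ g v <= f v)).
  - intros. lia.
  - apply dec_and; apply dec_le; auto.
Qed.

Lemma nth_map_seq (h : nat -> nat) n i : i < n -> nth i (map h (seq 0 n)) 0 = h i.
Proof.
  intros L. rewrite nth_indep with (d' := h 0) by (rewrite length_map, length_seq; auto).
  rewrite map_nth, seq_nth; auto.
Qed.

(** Whole argument lists are treated as computable objects, so that substitution also covers lists
    assembled with [tl], [::] and [map]. *)
Definition comp_vec (k m : nat) (G : list nat -> list nat) : Prop :=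
  (forall v, length v = k -> length (G v) = m) /\
  forall i, i < m -> comp_fun k (fun v => nth i (G v) 0).

Lemma comp_fun_vec k m f G :
  comp_fun m f -> comp_vec k m G -> comp_fun k (fun v => f (G v)).
Proof.
  intros F [L C].
  refine (comp_fun_ext _ _ _ _
    (comp_fun_subst k f (map (fun i v => nth i (G v) 0) (seq 0 m)) _ _)).
  - intros v Lv. simpl. f_equal. rewrite map_map.
    apply nth_ext with 0 0; rewrite length_map, length_seq; [rewrite L; auto|].
    intros i Hi.
    rewrite nth_map_seq by lia. auto.
  - rewrite length_map, length_seq. auto.
  - apply Forall_forall. intros g Hg. apply in_map_iff in Hg. destruct Hg as [i [<- Hi]].
    apply in_seq in Hi. apply C. lia.
Qed.

Lemma comp_vec_id k : comp_vec k k (fun v => v).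
Proof. split; auto. intros. apply comp_fun_nth; auto. Qed.

Lemma comp_vec_cons k m g G :
  comp_fun k g -> comp_vec k m G -> comp_vec k (S m) (fun v => g v :: G v).
Proof.
  intros Hg [L C]. split; [simpl; auto|]. intros [|i] Hi; [auto|]. apply C. lia.
Qed.

Lemma comp_vec_tl k m G : comp_vec k (S m) G -> comp_vec k m (fun v => tl (G v)).
Proof.
  intros [L C]. split.
  - intros v Lv. specialize (L v Lv). destruct (G v); simpl in *; lia.
  - intros i Hi. apply (comp_fun_ext k (fun v => nth (S i) (G v) 0)); [|apply C; lia].
    intros v _. destruct (G v); auto. destruct i; auto.
Qed.

Lemma comp_vec_map k gs :
  Forall (comp_fun k) gs -> comp_vec k (length gs) (fun v => map (fun g => g v) gs).
Proof.
  induction 1; simpl.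
  - split; auto. intros. lia.
  - apply comp_vec_cons; auto.
Qed.

Lemma comp_fun_nth_vec k m i G :
  comp_vec k m G -> i < m -> comp_fun k (fun v => nth i (G v) 0).
Proof. intros [_ C]. auto. Qed.

Lemma comp_fun_hd k m G : comp_vec k (S m) G -> comp_fun k (fun v => hd 0 (G v)).
Proof.
  intros [_ C]. apply (comp_fun_ext k (fun v => nth 0 (G v) 0)); [|apply C; lia].
  intros v _. destruct (G v); auto.
Qed.

Lemma comp_fun_tl k f : comp_fun k f -> comp_fun (S k) (fun w => f (tl w)).
Proof. intros F. apply (comp_fun_vec (S k) k f (@tl nat) F), comp_vec_tl, comp_vec_id. Qed.

Lemma dec_vec k m P G : dec m P -> comp_vec k m G -> dec k (fun v => P (G v)).
Proof.
  intros [f [F H]] C. exists (fun v => f (G v)). split; [apply (comp_fun_vec k m); auto|].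
  intros v L. apply H, C, L.
Qed.

(** All of finitely many values are zero exactly when their sum is, and the sum is primitive
    recursive. *)
Lemma dec_forall_lt k P b :
  dec (S k) P -> comp_fun k b -> dec k (fun v => forall i, i < b v -> P (i :: v)).
Proof.
  intros [g [G H]] B.
  set (sum := fun w => nat_rec (fun _ => nat) 0
    (fun n r => r + g (n :: tl w)) (nth 0 w 0)).
  assert (C : comp_fun (S k) sum).
  { apply (comp_fun_prec k (fun _ => 0) (fun w => hd 0 (tl w) + g (hd 0 w :: tl (tl w)))).
    - apply comp_fun_const.
    - apply comp_fun_app2; auto using comp2_add.
      + eapply comp_fun_hd, comp_vec_tl, comp_vec_id.
      + apply (comp_fun_vec _ (S k)); auto. apply comp_vec_cons.
        * eapply comp_fun_hd, comp_vec_id.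
        * do 2 apply comp_vec_tl. apply comp_vec_id. }
  assert (E : forall x v, length v = k -> (sum (x :: v) = 0 <-> forall i, i < x -> P (i :: v))).
  { intros x v L. unfold sum. simpl. induction x as [|x IH]; simpl.
    - split; auto. intros. lia.
    - split.
      + intros Z i Hi. destruct (Nat.eq_dec i x) as [->|N].
        * apply H; simpl; lia.
        * apply IH; lia.
      + intros A. rewrite (proj2 IH). simpl. apply H; simpl; auto. intros. apply A; lia. }
  assert (D : dec (S k) (fun w => sum w = 0)).
  { exists sum. split; auto. tauto. }
  refine (dec_ext _ _ _ _ (dec_vec k (S k) _ _ D (comp_vec_cons k k b _ B (comp_vec_id k)))).
  intros v L. apply E; auto.
Qed.

(* Sigma_1 predicates; the witness is the head of the argument list. *)
Definition sd (k : nat) (P : list nat -> Prop) : Prop :=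
  exists Q, dec (S k) Q /\ forall v, length v = k -> (P v <-> exists t, Q (t :: v)).

Lemma sd_ext k P Q :
  (forall v, length v = k -> (P v <-> Q v)) -> sd k P -> sd k Q.
Proof. intros E [D [HD H]]. exists D. split; auto. intros v L. rewrite <- E, H; tauto. Qed.

Lemma sd_dec k P : dec k P -> sd k P.
Proof.
  intros D. exists (fun w => P (tl w)). split; [apply (dec_vec _ k), comp_vec_tl, comp_vec_id; auto|].
  simpl. intros. split; [exists 0; auto | intros [_ ?]; auto].
Qed.

Lemma sd_or k P Q : sd k P -> sd k Q -> sd k (fun v => P v \/ Q v).
Proof.
  intros [D [HD H]] [D' [HD' H']]. exists (fun w => D w \/ D' w).
  split; [apply dec_or; auto|]. intros. rewrite H, H'; auto.
  split; [intros [[t ?]|[t ?]]; exists t; auto | intros [t [?|?]]; eauto].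
Qed.

Lemma sd_vec k m P G : sd m P -> comp_vec k m G -> sd k (fun v => P (G v)).
Proof.
  intros [D [HD H]] C. exists (fun w => D (hd 0 w :: G (tl w))). split.
  - apply (dec_vec _ (S m)); auto. apply comp_vec_cons.
    + eapply comp_fun_hd, comp_vec_id.
    + split; [intros [|] L; [discriminate|]; apply C; simpl in *; lia|].
      intros i Hi. apply (comp_fun_tl k (fun v => nth i (G v) 0)), C, Hi.
  - intros v L. apply H, C, L.
Qed.

Lemma sd_false k : sd k (fun _ => False).
Proof.
  apply sd_dec. apply (dec_ext k (fun _ => 1 <= 0)); [intros; lia|].
  apply dec_le; apply comp_fun_const.
Qed.

Lemma sd_app1 k (A : nat -> Prop) g :
  sd 1 (fun v => A (nth 0 v 0)) -> comp_fun k g -> sd k (fun v => A (g v)).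
Proof. intros F G. apply (sd_vec k 1 _ _ F (comp_vec_map k [g] ltac:(auto))). Qed.

Lemma sd_app2 k (A : nat -> nat -> Prop) g h :
  sd 2 (fun v => A (nth 0 v 0) (nth 1 v 0)) -> comp_fun k g -> comp_fun k h ->
  sd k (fun v => A (g v) (h v)).
Proof. intros F G H. apply (sd_vec k 2 _ _ F (comp_vec_map k [g; h] ltac:(auto))). Qed.

(** * Closure properties that use the given enumerations *)

Variables (q : nat -> Q) (tau1 tau2 : nat -> nat) (sigma : nat -> nat -> nat) (eta : nat -> nat).
Hypothesis ED : enum_data q tau1 tau2 sigma eta.

Lemma comp_tau1 : comp1 tau1. Proof. apply ED. Qed.
Lemma comp_tau2 : comp1 tau2. Proof. apply ED. Qed.
Lemma comp_sigma : comp2 sigma. Proof. apply ED. Qed.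
Lemma comp_eta : comp1 eta. Proof. apply ED. Qed.
Lemma tau_surj a b : exists i, tau1 i = a /\ tau2 i = b. Proof. apply ED. Qed.

Lemma sigma_surj s :
  s <> nil -> exists j, length s = S (eta j) /\ forall i, i <= eta j -> sigma j i = nth i s 0.
Proof. apply ED. Qed.

(** [sigma] plays the part of Goedel's beta function: one number codes any finite table. The table
    is taken one entry longer because only nonempty sequences are coded. *)
Lemma sigma_code (h : nat -> nat) b : exists j, forall i, i < b -> sigma j i = h i.
Proof.
  destruct (sigma_surj (map h (seq 0 (S b)))) as [j [L H]]; [discriminate|].
  rewrite length_map, length_seq in L. exists j. intros i Hi. rewrite H by lia.
  apply nth_map_seq. lia.
Qed.

(** [tau1] and [tau2] serve as projections from a pairing, by which two witnesses become one. *)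
Lemma sd_ex k (P : nat -> list nat -> Prop) :
  sd (S k) (fun w => P (hd 0 w) (tl w)) -> sd k (fun v => exists i, P i v).
Proof.
  intros [D [HD H]].
  exists (fun w => D (tau1 (hd 0 w) :: tau2 (hd 0 w) :: tl w)). split.
  - apply (dec_vec _ (S (S k))); auto. repeat apply comp_vec_cons.
    + apply comp_fun_app1; [apply comp_tau1|]. eapply comp_fun_hd, comp_vec_id.
    + apply comp_fun_app1; [apply comp_tau2|]. eapply comp_fun_hd, comp_vec_id.
    + apply comp_vec_tl, comp_vec_id.
  - intros v L. split.
    + intros [i Hi]. apply (H (i :: v)) in Hi; [|simpl; lia]. destruct Hi as [t Ht].
      destruct (tau_surj t i) as [u [Hu Hu']]. subst t i. exists u. auto.
    + intros [t Ht]. exists (tau2 (hd 0 (t :: v))).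
      apply (H (tau2 (hd 0 (t :: v)) :: v)); [simpl; lia|]. eexists. exact Ht.
Qed.

Lemma sd_and k P Q : sd k P -> sd k Q -> sd k (fun v => P v /\ Q v).
Proof.
  intros [D [HD H]] [D' [HD' H']].
  apply (sd_ext k (fun v => exists i, exists i', D (i :: v) /\ D' (i' :: v))).
  - intros v L. rewrite H, H'; auto. firstorder.
  - apply sd_ex, sd_ex, sd_dec, dec_and; apply (dec_vec _ (S k)); auto; apply comp_vec_cons.
    + eapply comp_fun_hd, comp_vec_tl, comp_vec_id.
    + do 2 apply comp_vec_tl. apply comp_vec_id.
    + eapply comp_fun_hd, comp_vec_id.
    + do 2 apply comp_vec_tl. apply comp_vec_id.
Qed.

(** Collection: the witnesses for all [i < b v] form a finite table, coded by a single [j]. *)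
Lemma sd_forall_lt k (P : nat -> list nat -> Prop) b :
  sd (S k) (fun w => P (hd 0 w) (tl w)) -> comp_fun k b ->
  sd k (fun v => forall i, i < b v -> P i v).
Proof.
  intros [D [HD H]] B.
  apply (sd_ext k (fun v => exists j, forall i, i < b v -> D (sigma j i :: i :: v))).
  - intros v L. split.
    + intros [j Hj] i Hi. apply (H (i :: v)); simpl; eauto.
    + intros A.
      assert (M : forall i, exists t, i < b v -> D (t :: i :: v)).
      { intros i. destruct (le_lt_dec (b v) i) as [N|N].
        - exists 0. lia.
        - destruct (proj1 (H (i :: v) ltac:(simpl; lia)) (A i N)) as [t Ht]. eauto. }
      apply choice in M. destruct M as [h Hh].
      destruct (sigma_code h (b v)) as [j Hj]. exists j. intros i Hi. rewrite Hj; auto.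
  - apply sd_ex, sd_dec.
    refine (dec_ext _ _ _ _ (dec_forall_lt (S k)
      (fun w => D (sigma (hd 0 (tl w)) (hd 0 w) :: hd 0 w :: tl (tl w)))
      (fun w => b (tl w)) _ _)).
    + intros [|x v] L; [discriminate|]. simpl. tauto.
    + apply (dec_vec _ (S (S k))); auto. repeat apply comp_vec_cons.
      * apply comp_fun_app2; [apply comp_sigma| |].
        -- eapply comp_fun_hd, comp_vec_tl, comp_vec_id.
        -- eapply comp_fun_hd, comp_vec_id.
      * eapply comp_fun_hd, comp_vec_id.
      * do 2 apply comp_vec_tl. apply comp_vec_id.
    + apply comp_fun_tl; auto.
Qed.

Lemma sd_and_list {A} k (l : list A) (P : A -> list nat -> Prop) :
  (forall x, In x l -> sd k (P x)) -> sd k (fun v => forall x, In x l -> P x v).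
Proof.
  induction l as [|x l IH]; intros H.
  - apply (sd_ext k (fun _ => 0 <= 0)); [simpl; intros; split; [intros _ _ []|lia]|].
    apply sd_dec, dec_le; apply comp_fun_const.
  - apply (sd_ext k (fun v => P x v /\ forall y, In y l -> P y v)).
    + intros v _. simpl. split; [intros [? ?] ? [<-|?]; auto|auto].
    + apply sd_and; [|apply IH]; intros; apply H; simpl; auto.
Qed.

Lemma sd_or_list {A} k (l : list A) (P : A -> list nat -> Prop) :
  (forall x, In x l -> sd k (P x)) -> sd k (fun v => exists x, In x l /\ P x v).
Proof.
  induction l as [|x l IH]; intros H.
  - apply (sd_ext k (fun _ => False)); [simpl; firstorder|]. apply sd_false.
  - apply (sd_ext k (fun v => P x v \/ exists y, In y l /\ P y v)).
    + intros v _. simpl. split; [intros [?|[y [? ?]]]; eauto|intros [y [[<-|?] ?]]; eauto].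
    + apply sd_or; [|apply IH]; intros; apply H; simpl; auto.
Qed.

(** * The graph of a partial recursive function is Sigma_1 *)

(** The induction hypothesis has to reach the codes inside the list of a [CComp]. *)
Fixpoint code_nested_ind (P : code -> Prop) (h0 : P CZero) (h1 : P CSucc)
  (h2 : forall i, P (CProj i)) (h3 : forall f gs, P f -> Forall P gs -> P (CComp f gs))
  (h4 : forall f g, P f -> P g -> P (CPrec f g)) (h5 : forall f, P f -> P (CMu f)) (c : code) : P c :=
  let rec := code_nested_ind P h0 h1 h2 h3 h4 h5 in
  match c with
  | CZero => h0
  | CSucc => h1
  | CProj i => h2 i
  | CComp f gs => h3 f gs (rec f)
      ((fix all l : Forall P l := match l with
        | nil => Forall_nil P | g :: l => Forall_cons g (rec g) (all l) end) gs)
  | CPrec f g => h4 f g (rec f) (rec g)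
  | CMu f => h5 f (rec f)
  end.

Lemma evals_nth gs v ys :
  evals gs v ys <-> length ys = length gs /\ forall i, i < length gs -> eval (nth i gs CZero) v (nth i ys 0).
Proof.
  revert ys. induction gs as [|g gs IH]; intros ys; split.
  - inversion 1. subst. simpl. split; auto. intros. lia.
  - intros [L _]. destruct ys; [|discriminate]. constructor.
  - inversion 1; subst. apply IH in H5. destruct H5 as [L H5]. simpl. split; auto.
    intros [|i] Hi; auto.
  - intros [L H]. destruct ys as [|y ys]; [discriminate|]. constructor.
    + apply (H 0). simpl. lia.
    + apply IH. split; auto. intros i Hi. apply (H (S i)). simpl. lia.
Qed.

Lemma eval_comp_iff f gs v y :
  eval (CComp f gs) v y <-> exists j,
    (forall i, In i (seq 0 (length gs)) -> eval (nth i gs CZero) v (sigma j i)) /\ eval f (map (sigma j) (seq 0 (length gs))) y.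
Proof.
  split.
  - inversion 1; subst. apply evals_nth in H2. destruct H2 as [L E].
    destruct (sigma_code (fun i => nth i ys 0) (length gs)) as [j Hj]. exists j. split.
    + intros i Hi. apply in_seq in Hi. rewrite Hj by lia. apply E. lia.
    + replace (map _ _) with ys; auto.
      apply nth_ext with 0 0; [rewrite length_map, length_seq; auto|]. intros i Hi. rewrite L in Hi.
      rewrite nth_map_seq by lia. rewrite Hj; auto.
  - intros [j [E F]]. econstructor; [|exact F]. apply evals_nth.
    rewrite length_map, length_seq. split; auto. intros i Hi.
    rewrite nth_map_seq by lia. apply E, in_seq. lia.
Qed.

(** The table of intermediate values, coded by [j], turns the recursion into a bounded quantifier
    over local checks. *)
Lemma eval_prec_iff f g n v y :
  eval (CPrec f g) (n :: v) y <-> exists j,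
    eval f v (sigma j 0) /\ (forall i, i < n -> eval g (i :: sigma j i :: v) (sigma j (S i))) /\ y = sigma j n.
Proof.
  split.
  - intros E.
    assert (exists h : nat -> nat, eval f v (h 0) /\   (forall i, i < n -> eval g (i :: h i :: v) (h (S i))) /\ y = h n) as [h [H0 [HS ->]]].
    { revert y E. induction n as [|n IH]; intros y E; inversion E; subst.
      - exists (fun _ => y). repeat split; auto. intros. lia.
      - destruct (IH r ltac:(assumption)) as [h [H0 [HS ->]]].
        exists (fun i => if Nat.eq_dec i (S n) then y else h i). repeat split; auto.
        + intros i Hi. destruct (Nat.eq_dec i (S n)), (Nat.eq_dec (S i) (S n)); try lia.
          * assert (i = n) by lia. subst. auto.
          * apply HS. lia.
        + destruct (Nat.eq_dec (S n) (S n)); tauto. }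
    destruct (sigma_code h (S n)) as [j Hj]. exists j.
    rewrite !Hj by lia. repeat split; auto. intros i Hi. rewrite !Hj by lia. auto.
  - intros [j [H0 [HS ->]]]. induction n as [|n IH].
    + constructor; auto.
    + econstructor; [apply IH; auto|]. apply HS. lia.
Qed.

Lemma eval_mu_iff f v n :
  eval (CMu f) v n <-> eval f (n :: v) 0 /\ forall m, m < n -> exists k, eval f (m :: v) (S k).
Proof. split; [inversion 1; auto | intros [? ?]; constructor; auto]. Qed.

Lemma sd_eval c : forall k, sd (S k) (fun w => eval c (tl w) (hd 0 w)).
Proof.
  induction c as [| |i|f gs IHf IHgs|f g IHf IHg|f IHf] using code_nested_ind; intros k.
  - apply (sd_ext (S k) (fun w => hd 0 w = 0)).
    + intros w _. split; [intros ->; constructor|inversion 1; auto].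
    + apply sd_dec, dec_eq; [eapply comp_fun_hd, comp_vec_id|apply comp_fun_const].
  - destruct k as [|k].
    + apply (sd_ext 1 (fun _ => False)); [|apply sd_false].
      intros [|y [|]] L; try discriminate. simpl. split; [tauto|inversion 1].
    + apply (sd_ext (S (S k)) (fun w => hd 0 w = S (hd 0 (tl w)))).
      * intros [|y [|x v]] L; try discriminate. simpl. split; [intros ->; constructor|inversion 1; auto].
      * apply sd_dec, dec_eq; [eapply comp_fun_hd, comp_vec_id|].
        apply comp_fun_app1; [apply comp1_S|eapply comp_fun_hd, comp_vec_tl, comp_vec_id].
  - destruct (le_lt_dec k i) as [N|N].
    + apply (sd_ext (S k) (fun _ => False)); [|apply sd_false].
      intros [|y v] L; try discriminate. simpl in *. split; [tauto|inversion 1; lia].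
    + apply (sd_ext (S k) (fun w => hd 0 w = nth i (tl w) 0)).
      * intros [|y v] L; try discriminate. simpl in *. split; [|inversion 1; auto].
        intros ->. constructor. lia.
      * apply sd_dec, dec_eq; [eapply comp_fun_hd, comp_vec_id|].
        eapply comp_fun_nth_vec; [apply comp_vec_tl, comp_vec_id|auto].
  - refine (sd_ext _ _ _ (fun w _ => iff_sym (eval_comp_iff f gs (tl w) (hd 0 w))) _).
    apply sd_ex, sd_and.
    + apply sd_and_list. intros i Hi. apply in_seq in Hi. rewrite Forall_forall in IHgs.
      refine (sd_vec _ (S k) _ (fun w => sigma (hd 0 w) i :: tl (tl w)) (IHgs (nth i gs CZero) _ k) _).
      * apply nth_In. lia.
      * apply comp_vec_cons; [|do 2 apply comp_vec_tl; apply comp_vec_id].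
        apply comp_fun_app2; [apply comp_sigma| |apply comp_fun_const]. eapply comp_fun_hd, comp_vec_id.
    + refine (sd_vec _ _ _ (fun w => hd 0 (tl w) :: map (sigma (hd 0 w)) (seq 0 (length gs)))
        (IHf (length gs)) _).
      apply comp_vec_cons; [eapply comp_fun_hd, comp_vec_tl, comp_vec_id|].
      split; [intros; rewrite length_map, length_seq; auto|]. intros i Hi.
      apply (comp_fun_ext _ (fun w => sigma (hd 0 w) i)).
      * intros w _. rewrite nth_map_seq by lia. auto.
      * apply comp_fun_app2; [apply comp_sigma| |apply comp_fun_const]. eapply comp_fun_hd, comp_vec_id.
  - destruct k as [|k].
    + apply (sd_ext 1 (fun _ => False)); [|apply sd_false].
      intros [|y [|]] L; try discriminate. simpl. split; [tauto|inversion 1].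
    + apply (sd_ext (S (S k)) (fun w => exists j,
        eval f (tl (tl w)) (sigma j 0) /\     (forall i, i < hd 0 (tl w) -> eval g (i :: sigma j i :: tl (tl w)) (sigma j (S i))) /\   hd 0 w = sigma j (hd 0 (tl w)))).
      * intros [|y [|n v]] L; try discriminate. simpl. symmetry. apply eval_prec_iff.
      * apply sd_ex, sd_and; [|apply sd_and].
        -- refine (sd_vec _ (S k) _ (fun w => sigma (hd 0 w) 0 :: tl (tl (tl w))) (IHf k) _).
           apply comp_vec_cons; [|do 3 apply comp_vec_tl; apply comp_vec_id].
           apply comp_fun_app2; [apply comp_sigma| |apply comp_fun_const]. eapply comp_fun_hd, comp_vec_id.
        -- apply sd_forall_lt; [|eapply comp_fun_hd; do 2 apply comp_vec_tl; apply comp_vec_id].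
           refine (sd_vec _ (S (S (S k))) _ (fun w => sigma (hd 0 (tl w)) (S (hd 0 w)) :: hd 0 w ::
             sigma (hd 0 (tl w)) (hd 0 w) :: tl (tl (tl (tl w)))) (IHg _) _).
           assert (comp_fun (S (S (S (S k)))) (hd 0)) by (eapply comp_fun_hd, comp_vec_id).
           assert (comp_fun (S (S (S (S k)))) (fun w => hd 0 (tl w)))
             by (eapply comp_fun_hd, comp_vec_tl, comp_vec_id).
           repeat apply comp_vec_cons; auto.
           ++ apply comp_fun_app2; [apply comp_sigma|auto|apply comp_fun_app1; auto using comp1_S].
           ++ apply comp_fun_app2; [apply comp_sigma|auto|auto].
           ++ do 4 apply comp_vec_tl; apply comp_vec_id.
        -- apply sd_dec, dec_eq; [eapply comp_fun_hd, comp_vec_tl, comp_vec_id|].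
           apply comp_fun_app2; [apply comp_sigma| |].
           ++ eapply comp_fun_hd, comp_vec_id.
           ++ eapply comp_fun_hd; do 2 apply comp_vec_tl; apply comp_vec_id.
  - refine (sd_ext _ _ _ (fun w _ => iff_sym (eval_mu_iff f (tl w) (hd 0 w))) _).
    apply sd_and.
    + refine (sd_vec _ (S (S k)) _ (fun w => 0 :: hd 0 w :: tl w) (IHf _) _).
      repeat apply comp_vec_cons; [apply comp_fun_const|eapply comp_fun_hd, comp_vec_id|].
      apply comp_vec_tl, comp_vec_id.
    + apply sd_forall_lt; [|eapply comp_fun_hd, comp_vec_id]. apply sd_ex.
      refine (sd_vec _ (S (S k)) _ (fun w => S (hd 0 w) :: hd 0 (tl w) :: tl (tl (tl w))) (IHf _) _).
      repeat apply comp_vec_cons.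
      * apply comp_fun_app1; [apply comp1_S|eapply comp_fun_hd, comp_vec_id].
      * eapply comp_fun_hd, comp_vec_tl, comp_vec_id.
      * do 3 apply comp_vec_tl; apply comp_vec_id.
Qed.

Lemma sd_ce (A : nat -> Prop) : ce A -> sd 1 (fun v => A (nth 0 v 0)).
Proof.
  intros [c H]. apply (sd_ext 1 (fun v => exists y, eval c v y)).
  - intros [|j [|]] L; try discriminate. symmetry. apply H.
  - apply sd_ex, sd_eval.
Qed.

(** Minimization runs over pairs of a Sigma_1 witness and a value [m], because only with the witness
    is the relation decidable. *)
Lemma sd_select (R : nat -> nat -> Prop) :
  sd 2 (fun v => R (nth 0 v 0) (nth 1 v 0)) -> (forall k, exists m, R k m) ->
  exists f, comp1 f /\ forall k, R k (f k).
Proof.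
  intros [D [[g [G Hg]] H]] T.
  destruct (comp_fun_mu 1 (fun w => g [tau1 (nth 0 w 0); nth 1 w 0; tau2 (nth 0 w 0)]))
    as [h [Hc Hh]].
  - apply comp_fun_app3; auto.
    + apply comp_fun_app1; [apply comp_tau1|apply comp_fun_nth; lia].
    + apply comp_fun_nth; lia.
    + apply comp_fun_app1; [apply comp_tau2|apply comp_fun_nth; lia].
  - intros [|k [|]] L; try discriminate. destruct (T k) as [m Hm].
    apply (H [k; m] eq_refl) in Hm. destruct Hm as [t Ht].
    destruct (tau_surj t m) as [n [Et Em]]. exists n. simpl. rewrite Et, Em. simpl. apply Hg; auto.
  - exists (fun k => tau2 (h [k])). split.
    + apply (comp_fun_ext 1 (fun v => tau2 (h v))).
      * intros [|k [|]] L; try discriminate. reflexivity.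
      * apply comp_fun_app1; [apply comp_tau2|auto].
    + intros k. apply (H [k; tau2 (h [k])] eq_refl). exists (tau1 (h [k])).
      apply Hg; auto. exact (Hh [k] eq_refl).
Qed.

(** * Rational-valued computable functions *)

Definition comp_rat (k : nat) (g : list nat -> R) : Prop :=
  exists a b c, comp_fun k a /\ comp_fun k b /\ comp_fun k c /\
    forall v, length v = k -> g v = rat_of (a v) (b v) (c v).

Lemma INR_S_neq0 n : INR (S n) <> 0%R.
Proof. apply not_0_INR. lia. Qed.

Lemma comp_rat_add k f g : comp_rat k f -> comp_rat k g -> comp_rat k (fun v => f v + g v)%R.
Proof.
  intros (a & b & c & A & B & C & F) (a' & b' & c' & A' & B' & C' & G).
  exists (fun v => a v * S (c' v) + a' v * S (c v)), (fun v => b v * S (c' v) + b' v * S (c v)),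
    (fun v => c v * S (c' v) + c' v).
  assert (D := comp_fun_app1 k S c comp1_S C). assert (D' := comp_fun_app1 k S c' comp1_S C').
  assert (P : forall x y, comp_fun k x -> comp_fun k y -> comp_fun k (fun v => x v + y v))
    by (intros; apply (comp_fun_app2 k Nat.add); auto using comp2_add).
  assert (M : forall x y, comp_fun k x -> comp_fun k y -> comp_fun k (fun v => x v * y v))
    by (intros; apply (comp_fun_app2 k Nat.mul); auto using comp2_mul).
  split; [|split; [|split]].
  { apply P; apply M; auto. }
  { apply P; apply M; auto. }
  { apply P; [apply M|]; auto. }
  intros v L. rewrite F, G by auto. unfold rat_of.
  replace (S (c v * S (c' v) + c' v)) with (S (c v) * S (c' v)) by ring.
  rewrite !plus_INR, !mult_INR. field. split; apply INR_S_neq0.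
Qed.

Lemma comp_rat_opp k f : comp_rat k f -> comp_rat k (fun v => - f v)%R.
Proof.
  intros (a & b & c & A & B & C & F). exists b, a, c. repeat split; auto.
  intros v L. rewrite F by auto. unfold rat_of. field. apply INR_S_neq0.
Qed.

Lemma comp_rat_pow_half k f : comp_fun k f -> comp_rat k (fun v => (/2) ^ (f v))%R.
Proof.
  intros F. exists (fun _ => 1), (fun _ => 0), (fun v => Nat.pred (2 ^ f v)).
  repeat split; auto using comp_fun_const.
  - apply comp_fun_app1; [apply comp1_pred|]. apply comp_fun_app1; [apply comp1_pow2|auto].
  - intros v _. unfold rat_of. rewrite Nat.succ_pred by (apply Nat.pow_nonzero; lia).
    rewrite pow_INR, pow_inv. replace (INR 2) with 2%R by (simpl; ring).
    change (INR 1) with 1%R. change (INR 0) with 0%R. field. apply pow_nonzero. lra.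
Qed.

Lemma dec_rat_pos k f : comp_rat k f -> dec k (fun v => 0 < f v)%R.
Proof.
  intros (a & b & c & A & B & C & F). apply (dec_ext k (fun v => S (b v) <= a v)).
  - intros v L. rewrite F by auto. unfold rat_of, Rdiv.
    assert (P : (0 < / INR (S (c v)))%R) by (apply Rinv_0_lt_compat, lt_0_INR; lia). split.
    + intros H. apply lt_INR in H. apply Rmult_lt_0_compat; auto. lra.
    + intros H. apply INR_lt.
      destruct (Rlt_le_dec (INR (b v)) (INR (a v))) as [|N]; auto. nra.
  - apply dec_le; auto. apply comp_fun_app1; auto using comp1_S.
Qed.

Lemma comp_rat_q k f : comp_fun k f -> comp_rat k (fun v => Q2R (q (f v))).
Proof.
  intros F. destruct ED as [[a [b [c [A [B [C H]]]]]] _].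
  exists (fun v => a (f v)), (fun v => b (f v)), (fun v => c (f v)).
  repeat split; auto using comp_fun_app1.
Qed.

Definition rho (i : nat) : R := Q2R (q (tau2 i)).

Lemma sd_rho_small : sd 2 (fun v => (rho (nth 0 v 0%nat) < (/2) ^ (nth 1 v 0%nat))%R).
Proof.
  apply (sd_ext 2 (fun v => (0 < (/2) ^ (nth 1 v 0%nat) + - rho (nth 0 v 0%nat))%R)); [intros; lra|].
  apply sd_dec, dec_rat_pos, comp_rat_add.
  - apply comp_rat_pow_half, comp_fun_nth. lia.
  - apply comp_rat_opp, comp_rat_q, comp_fun_app1; [apply comp_tau2|apply comp_fun_nth; lia].
Qed.

(** * Rational balls in a computable metric space *)

Section Space.
Local Open Scope R_scope.
Context {X : Type} (d : X -> X -> R) (alpha : nat -> X).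
Hypothesis CMS : computable_metric_space d alpha.

Definition lam (i : nat) : X := alpha (tau1 i).
Definition ball (i : nat) (y : X) : Prop := d y (lam i) < rho i.
(** Implies disjointness of the balls, and is semidecidable because the inequality is strict. *)
Definition formally_disjoint (i j : nat) : Prop := rho i + rho j < d (lam i) (lam j).

Lemma pow_half_pos t : 0 < (/2) ^ t.
Proof. apply pow_lt. lra. Qed.

Lemma pow_half_small eps : 0 < eps -> exists t, (/2) ^ t < eps.
Proof.
  intros H. destruct (pow_lt_1_zero (/2)) with (y := eps) as [N HN]; auto.
  - rewrite Rabs_pos_eq; lra.
  - exists N. specialize (HN N (le_n N)). rewrite Rabs_pos_eq in HN; auto.
    apply Rlt_le, pow_half_pos.
Qed.

Lemma sd_formally_disjoint : sd 2 (fun v => formally_disjoint (nth 0 v 0%nat) (nth 1 v 0%nat)).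
Proof.
  destruct CMS as [_ [_ [a [b [c [A [B [C H]]]]]]]].
  set (D := fun i j t => rat_of (a [i; j; t]) (b [i; j; t]) (c [i; j; t])).
  assert (HD : forall i j t, Rabs (d (alpha i) (alpha j) - D i j t) < (/2) ^ t)
    by (intros i j t; apply (H [i; j] t eq_refl)).
  apply (sd_ext 2 (fun v => exists t, 0 < D (tau1 (nth 0 v 0%nat)) (tau1 (nth 1 v 0%nat)) t
    + - (/2) ^ t + - rho (nth 0 v 0%nat) + - rho (nth 1 v 0%nat))).
  - intros [|i [|j [|]]] L; try discriminate. simpl. unfold formally_disjoint, lam. split.
    + intros [t Ht]. specialize (HD (tau1 i) (tau1 j) t). apply Rabs_def2 in HD. lra.
    + intros F.
      (* Half of the excess, since the error of the approximation is paid twice: in [D] itself and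
         as the subtracted safety margin. *)
      destruct (pow_half_small ((d (alpha (tau1 i)) (alpha (tau1 j)) - rho i - rho j) / 2)) as [t Ht];
        [lra|].
      exists t. specialize (HD (tau1 i) (tau1 j) t). apply Rabs_def2 in HD. lra.
  - apply sd_ex, sd_dec, dec_rat_pos.
    assert (T : comp_fun 3 (hd 0%nat)) by (eapply comp_fun_hd, comp_vec_id).
    assert (I : comp_fun 3 (fun w => nth 0 (tl w) 0%nat))
      by (eapply comp_fun_nth_vec; [apply comp_vec_tl, comp_vec_id|lia]).
    assert (J : comp_fun 3 (fun w => nth 1 (tl w) 0%nat))
      by (eapply comp_fun_nth_vec; [apply comp_vec_tl, comp_vec_id|lia]).
    assert (I1 := comp_fun_app1 3 _ _ comp_tau1 I). assert (J1 := comp_fun_app1 3 _ _ comp_tau1 J).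
    repeat apply comp_rat_add; try apply comp_rat_opp.
    + pose (G := fun f : list nat -> nat => fun w => f [tau1 (nth 0 (tl w) 0%nat); tau1 (nth 1 (tl w) 0%nat); hd 0%nat w]).
      assert (GC : forall f, comp_fun 3 f -> comp_fun 3 (G f)) by (intros; apply comp_fun_app3; auto).
      exists (G a), (G b), (G c). auto.
    + apply comp_rat_pow_half; auto.
    + apply comp_rat_q, comp_fun_app1; auto using comp_tau2.
    + apply comp_rat_q, comp_fun_app1; auto using comp_tau2.
Qed.

Lemma d_sym y y' : d y y' = d y' y. Proof. apply CMS. Qed.
Lemma d_tri y y' y'' : d y y'' <= d y y' + d y' y''. Proof. apply CMS. Qed.
Lemma formally_disjoint_ball i j y : formally_disjoint i j -> ball i y -> ball j y -> False.
Proof.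
  unfold formally_disjoint, ball. intros F B B'.
  assert (H := d_tri (lam i) y (lam j)). rewrite (d_sym (lam i) y) in H. lra.
Qed.

(** Passing from the two points to the centres costs less than e/4 at each end; the e/2 that is left
    exceeds the sum of the radii. *)
Lemma formally_disjoint_far e i i' y y' :
  ball i y -> ball i' y' -> rho i < e / 4 -> rho i' < e / 4 -> e <= d y y' ->
  formally_disjoint i i'.
Proof.
  unfold formally_disjoint, ball. intros B B' R R' E.
  assert (H := d_tri y (lam i) y'). assert (H' := d_tri (lam i) (lam i') y').
  rewrite (d_sym (lam i') y') in H'. lra.
Qed.

Lemma ball_open i : Defs.open_set d (ball i).
Proof.
  intros y B. exists (rho i - d y (lam i)). unfold ball in *. split; [lra|].
  intros y' H. assert (H' := d_tri y' y (lam i)). rewrite (d_sym y' y) in H'. lra.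
Qed.

Lemma ball_exists y eps : 0 < eps -> exists i, ball i y /\ rho i < eps.
Proof.
  intros E. destruct (INR_unbounded (/ eps)) as [N HN].
  set (r := (1 # Pos.of_succ_nat N)%Q).
  assert (HR : Q2R r = / INR (S N)).
  { rewrite INR_IZR_INZ. change (Z.of_nat (S N)) with (Zpos (Pos.of_succ_nat N)).
    unfold Q2R, r. cbn [Qnum Qden]. ring. }
  assert (PN : 0 < INR (S N)) by (apply lt_0_INR; lia).
  assert (P : 0 < / INR (S N) < eps).
  { split; [apply Rinv_0_lt_compat; auto|].
    rewrite <- (Rinv_inv eps). apply Rinv_lt_contravar.
    - apply Rmult_lt_0_compat; auto. apply Rinv_0_lt_compat; auto.
    - rewrite S_INR. lra. }
  destruct ED as (_ & _ & Sq & _). destruct (Sq r) as [b Hb]; [reflexivity|].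
  destruct CMS as (_ & Den & _). destruct (Den y (/ INR (S N))) as [a Ha]; [tauto|].
  destruct (tau_surj a b) as [i [Ia Ib]]. exists i. unfold ball, lam, rho.
  rewrite Ia, Ib, (Qeq_eqR _ _ Hb), HR. split; [auto|lra].
Qed.

(** The finite subcover keeps with each ball the label in [A] under which it was chosen. *)
Lemma compact_ball_cover {A} (K : X -> Prop) (P : nat -> A -> Prop) :
  Defs.compact d K -> (forall y, K y -> exists i a, P i a /\ ball i y) ->
  exists l : list (nat * A), (forall i a, In (i, a) l -> P i a) /\
    forall y, K y -> exists i a, In (i, a) l /\ ball i y.
Proof.
  intros C H.
  destruct (C {ia : nat * A | P (fst ia) (snd ia)} (fun s => ball (fst (proj1_sig s)))) as [l Hl].
  - intros. apply ball_open.
  - intros y Ky. destruct (H y Ky) as [i [a [Pia B]]]. exists (exist _ (i, a) Pia). auto.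
  - exists (map (@proj1_sig _ _) l). split.
    + intros i a I. apply in_map_iff in I. destruct I as [[ia Pia] [E _]]. simpl in E. subst. auto.
    + intros y Ky. destruct (Hl y Ky) as [[[i a] Pia] [I B]]. exists i, a. split; auto.
      apply in_map_iff. eexists. split; [|exact I]. reflexivity.
Qed.

Lemma small_ball_cover (K : X -> Prop) e :
  Defs.compact d K -> 0 < e ->
  exists l, (forall i, In i l -> rho i < e) /\ forall y, K y -> exists i, In i l /\ ball i y.
Proof.
  intros C E. destruct (compact_ball_cover (A := unit) K (fun i _ => rho i < e) C) as [l [Hl Cl]].
  - intros y _. destruct (ball_exists y e E) as [i [B R]]. exists i, tt. auto.
  - exists (map fst l). split.
    + intros i I. apply in_map_iff in I. destruct I as [[i' u] [<- I]]. apply (Hl i' u I).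
    + intros y Ky. destruct (Cl y Ky) as [i [u [I B]]]. exists i. split; auto.
      apply in_map_iff. exists (i, u). auto.
Qed.

Lemma filter_classical {A} (l : list A) (P : A -> Prop) :
  exists l', forall x, In x l' <-> In x l /\ P x.
Proof.
  induction l as [|a l [l' IH]]; [exists nil; simpl; tauto|].
  destruct (classic (P a)) as [Pa|N].
  - exists (a :: l'). intros x. simpl. rewrite IH. split; [intros [<-|]; tauto|tauto].
  - exists l'. intros x. simpl. rewrite IH. split; [tauto|]. intros [[<-|] ?]; tauto.
Qed.

Lemma code_of_list (l : list nat) :
  l <> nil -> exists j, (forall a, (a < S (eta j))%nat -> In (sigma j a) l) /\
    forall i, In i l -> exists a, (a < S (eta j))%nat /\ sigma j a = i.
Proof.
  intros N. destruct (sigma_surj l N) as [j [L H]]. exists j. split.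
  - intros a La. rewrite H by lia. apply nth_In. lia.
  - intros i I. destruct (In_nth l i 0%nat I) as [a [La E]]. exists a.
    rewrite H by lia. split; [lia|auto].
Qed.

Lemma code_of_pairs (l : list (nat * nat)) :
  l <> nil -> exists j g, (forall a, (a < S (eta j))%nat -> In (sigma j a, sigma g a) l) /\
    forall i b, In (i, b) l -> exists a, (a < S (eta j))%nat /\ sigma j a = i.
Proof.
  intros N. destruct (sigma_surj (map fst l)) as [j [L H]]; [destruct l; [tauto|discriminate]|].
  destruct (sigma_surj (map snd l)) as [g [L' H']]; [destruct l; [tauto|discriminate]|].
  rewrite length_map in L, L'. exists j, g. split.
  - intros a La. rewrite H, H' by lia.
    assert (E1 := map_nth fst l (0%nat, 0%nat) a). assert (E2 := map_nth snd l (0%nat, 0%nat) a).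
    simpl in E1, E2. rewrite E1, E2, <- surjective_pairing.
    apply nth_In. lia.
  - intros i b I. destruct (In_nth l (i, b) (0%nat, 0%nat) I) as [a [La E]]. exists a. split; [lia|].
    rewrite H by lia. assert (E1 := map_nth fst l (0%nat, 0%nat) a). simpl in E1. rewrite E1, E. reflexivity.
Qed.

(** * From certified balls to approximating sets *)

Local Notation subJ := (sub_J d alpha q tau1 tau2 sigma eta).

Ltac vec := repeat first [apply comp_vec_id | apply comp_vec_tl].
Ltac cf := lazymatch goal with
  | |- comp_fun _ (fun v => sigma _ _) => apply (comp_fun_app2 _ sigma); [exact comp_sigma|cf|cf]
  | |- comp_fun _ (fun v => S _) => apply (comp_fun_app1 _ S); [exact comp1_S|cf]
  | |- comp_fun _ (fun v => eta _) => apply (comp_fun_app1 _ eta); [exact comp_eta|cf]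
  | |- comp_fun _ (fun v => tau1 _) => apply (comp_fun_app1 _ tau1); [exact comp_tau1|cf]
  | |- comp_fun _ (hd 0%nat) => eapply comp_fun_hd, comp_vec_id
  | |- comp_fun _ (fun v => hd 0%nat _) => eapply comp_fun_hd; vec
  | |- comp_fun _ (fun v => nth _ _ 0%nat) => eapply comp_fun_nth_vec; [vec|lia]
  | |- _ => apply comp_fun_const
  end.

(** Certificates are required up to the closed ball, since only a point strictly farther than
    [rho z] from the centre has a ball around it that is formally disjoint from [z]. *)
Lemma computable_up_to_of_certificates (K : X -> Prop) (cert : nat -> Prop) z x :
  semi_computable_compact d alpha q tau1 tau2 sigma eta K ->
  sd 1 (fun v => cert (nth 0 v 0%nat)) ->
  (forall i, cert i -> exists y, K y /\ ball i y) ->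
  (forall y i, K y -> d y (lam z) <= rho z -> ball i y -> cert i) ->
  K x -> ball z x ->
  computable_up_to d alpha sigma eta (fun y => K y /\ ball z y) K.
Proof.
  intros [KC Kce] Cc Snd Cmp Kx Bx.
  (* The first half puts every point of [K] in ball [z] close to a point of [Lambda] at [m]; the
     second puts every point of [Lambda] at [m] close to [K]. *)
  pose (R := fun k m =>
    (exists j, subJ K j /\ forall a, (a < S (eta j))%nat ->
       formally_disjoint (sigma j a) z \/ exists b, (b < S (eta m))%nat /\
         (tau1 (sigma j a) = sigma m b /\ rho (sigma j a) < (/2) ^ k)) /\
    forall b, (b < S (eta m))%nat ->
      exists i, tau1 i = sigma m b /\ (rho i < (/2) ^ k /\ cert i)).
  destruct (sd_select R) as [f [Cf Hf]].
  - unfold R. apply sd_and.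
    + apply sd_ex, sd_and.
      * apply sd_app1; [apply sd_ce, Kce|cf].
      * apply sd_forall_lt; [|cf]. apply sd_or.
        -- apply (sd_app2 _ formally_disjoint); [apply sd_formally_disjoint|cf|cf].
        -- apply sd_ex, sd_and; [|apply sd_and].
           ++ apply sd_dec, dec_le; cf.
           ++ apply sd_dec, dec_eq; cf.
           ++ apply (sd_app2 _ (fun i k => rho i < (/2) ^ k)); [apply sd_rho_small|cf|cf].
    + apply sd_forall_lt; [|cf]. apply sd_ex, sd_and; [|apply sd_and].
      * apply sd_dec, dec_eq; cf.
      * apply (sd_app2 _ (fun i k => rho i < (/2) ^ k)); [apply sd_rho_small|cf|cf].
      * apply sd_app1; [exact Cc|cf].
  - intros k.
    destruct (compact_ball_cover (A := unit) K
      (fun i _ => formally_disjoint i z \/ (rho i < (/2) ^ k /\ cert i)) KC) as [l [Hl Cl]].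
    { intros y Ky. destruct (Rlt_le_dec (rho z) (d y (lam z))) as [F|N].
      (* Half of the excess, as the radius counts twice: it displaces the centre and enters the sum
         of radii. *)
      - destruct (ball_exists y ((d y (lam z) - rho z) / 2)) as [i [B Ri]]; [lra|].
        exists i, tt. split; auto. left. unfold formally_disjoint, ball in *.
        assert (H := d_tri y (lam i) (lam z)). lra.
      - destruct (ball_exists y ((/2) ^ k) (pow_half_pos k)) as [i [B Ri]].
        exists i, tt. split; auto. right. eauto. }
    destruct (filter_classical (map fst l) (fun i => ~ formally_disjoint i z)) as [l' Hl'].
    destruct (code_of_list (map fst l)) as [j [Lj Cj]].
    { destruct (Cl x Kx) as [i [u [I _]]]. destruct l; [destruct I|discriminate]. }
    destruct (code_of_list (map tau1 l')) as [m [Lm Cm]].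
    { destruct (Cl x Kx) as [i [u [I B]]].
      assert (I' : In i l').
      { apply Hl'. split; [apply in_map_iff; exists (i, u); auto|].
        intros F. exact (formally_disjoint_ball _ _ _ F B Bx). }
      destruct l'; [destruct I'|discriminate]. }
    exists m. split.
    + exists j. split.
      * intros y Ky. destruct (Cl y Ky) as [i [u [I B]]].
        destruct (Cj i) as [a [La <-]]; [apply in_map_iff; exists (i, u); auto|].
        exists a. split; [lia|exact B].
      * intros a La. specialize (Lj a La). destruct (classic (formally_disjoint (sigma j a) z)) as [F|F]; auto.
        right. destruct (Cm (tau1 (sigma j a))) as [b [Lb E]].
        { apply in_map. apply Hl'. auto. }
        exists b. split; auto. split; auto.
        apply in_map_iff in Lj. destruct Lj as [[i u] [E' I]]. simpl in E'. subst i.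
        destruct (Hl _ _ I); tauto.
    + intros b Lb. specialize (Lm b Lb). apply in_map_iff in Lm. destruct Lm as [i [E I]].
      exists i. split; auto. apply Hl' in I. destruct I as [I F].
      apply in_map_iff in I. destruct I as [[i' u] [E' I]]. simpl in E'. subst i'.
      destruct (Hl _ _ I); tauto.
  - exists f. split; auto. intros k. destruct (Hf k) as [[j [Sj Hj]] Hm]. split.
    + intros y [Ky By]. destruct (Sj y Ky) as [a [La B]].
      destruct (Hj a ltac:(lia)) as [F|[b [Lb [E Ra]]]].
      * exfalso. exact (formally_disjoint_ball _ _ _ F B By).
      * exists (alpha (sigma (f k) b)). split; [exists b; split; [lia|auto]|].
        rewrite <- E. unfold rho in Ra. lra.
    + intros y [b [Lb ->]]. destruct (Hm b ltac:(lia)) as [i [<- [Ri Ci]]].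
      destruct (Snd i Ci) as [y [Ky B]]. exists y. split; auto.
      rewrite d_sym. unfold ball, lam in B. lra.
Qed.

(** * Certificates, their soundness and their completeness *)

Section Certificate.
Variables (K T : X -> Prop) (n : nat) (w : list nat) (lo hi : nat -> list nat).

(* Ball labels: c for U_c, n + c for V_c (c < n), 2n for the certified ball itself, 2n + 1 for the balls of w, which stay away from the cube. *)
Definition admissible (i0 i b : nat) : Prop :=
  (b = 2 * n /\ i = i0)%nat \/
  (b = 2 * n + 1 /\ exists i', In i' w /\ i = i')%nat \/
  exists c, In c (seq 0 n) /\
    ((b = c /\ forall i', In i' (hi c) -> formally_disjoint i i') \/
     (b = (n + c)%nat /\ forall i', In i' (lo c) -> formally_disjoint i i')).

(** [j] with labels [g] codes a cover of [K], and [t] one of [T]. Implications are written as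
    disjunctions, and memberships in fixed lists as finite disjunctions or conjunctions, so that the
    closure lemmas for [sd] apply directly. *)
Definition certificate (i0 : nat) : Prop :=
  exists j g t, (subJ K j /\ subJ T t) /\
   (forall a, (a < S (eta j))%nat -> admissible i0 (sigma j a) (sigma g a)) /\
   (forall a, (a < S (eta j))%nat -> forall a', (a' < S (eta j))%nat ->
      forall c, In c (seq 0 n) -> sigma g a <> c \/ (sigma g a' <> n + c)%nat \/
        formally_disjoint (sigma j a) (sigma j a')) /\
   (forall e, (e < S (eta t))%nat -> (exists i', In i' w /\ sigma t e = i') \/
      forall a, (a < S (eta j))%nat -> (sigma g a <> n + Nat.pred n)%nat \/
        formally_disjoint (sigma t e) (sigma j a)).

Lemma sd_certificate :
  ce (subJ K) -> ce (subJ T) -> sd 1 (fun v => certificate (nth 0 v 0%nat)).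
Proof.
  intros CK CT. unfold certificate, admissible.
  apply sd_ex, sd_ex, sd_ex, sd_and; [|apply sd_and; [|apply sd_and]].
  - apply sd_and.
    + apply (sd_app1 _ (subJ K)); [apply sd_ce, CK|cf].
    + apply (sd_app1 _ (subJ T)); [apply sd_ce, CT|cf].
  - apply sd_forall_lt; [|cf]. apply sd_or; [|apply sd_or].
    + apply sd_and; apply sd_dec, dec_eq; cf.
    + apply sd_and; [apply sd_dec, dec_eq; cf|].
      apply sd_or_list. intros i _. apply sd_dec, dec_eq; cf.
    + apply sd_or_list. intros c _. apply sd_or; (apply sd_and; [apply sd_dec, dec_eq; cf|]);
        apply sd_and_list; intros i _; apply (sd_app2 _ formally_disjoint);
        try apply sd_formally_disjoint; cf.
  - apply sd_forall_lt; [|cf]. apply sd_forall_lt; [|cf]. apply sd_and_list. intros c _.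
    apply sd_or; [|apply sd_or]; [apply sd_dec, dec_not, dec_eq; cf..|].
    apply (sd_app2 _ formally_disjoint); [apply sd_formally_disjoint|cf|cf].
  - apply sd_forall_lt; [|cf]. apply sd_or.
    + apply sd_or_list. intros i _. apply sd_dec, dec_eq; cf.
    + apply sd_forall_lt; [|cf]. apply sd_or; [apply sd_dec, dec_not, dec_eq; cf|].
      apply (sd_app2 _ formally_disjoint); [apply sd_formally_disjoint|cf|cf].
Qed.

Lemma certificate_sound (f : (nat -> R) -> X) l u i0 :
  (forall i, (i < n)%nat -> l i < u i) ->
  (forall p, box n l u p -> K (f p)) ->
  (forall t eps, box n l u t -> 0 < eps -> exists e, 0 < e /\
     forall p, box n l u p -> near n e t p -> d (f t) (f p) < eps) ->
  (forall p i, box n l u p -> In i w -> ~ ball i (f p)) ->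
  (forall c p, (c < n)%nat -> box n l u p -> p c = u c ->
     exists i, In i (hi c) /\ ball i (f p)) ->
  (forall c p, (c < n)%nat -> box n l u p -> p c = l c ->
     (exists i, In i (lo c) /\ ball i (f p)) \/ (c = Nat.pred n /\ T (f p))) ->
  certificate i0 -> exists y, K y /\ ball i0 y.
Proof.
  intros LU FK Fc Fw Fhi Flo (j & g & t & (Hj & Ht) & Adm & Dis & HT).
  apply NNPP. intros N.
  apply (box_not_separated n l u (fun c b p => exists a, (a < S (eta j))%nat /\
    sigma g a = (if b : bool then c else n + c)%nat /\ ball (sigma j a) (f p))); auto.
  - intros p Bp. destruct (Hj (f p) (FK p Bp)) as [a [La Ba]]. fold (rho (sigma j a)) in Ba.
    change (ball (sigma j a) (f p)) in Ba. assert (La' : (a < S (eta j))%nat) by lia.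
    destruct (ball_open _ _ Ba) as [r [r0 Hr]]. destruct (Fc p r Bp r0) as [e [E He]].
    destruct (Adm a La') as [[_ E0]|[[_ [i' [Iw E0]]]|[c [Ic H]]]].
    + exfalso. apply N. exists (f p). rewrite <- E0. auto.
    + exfalso. apply (Fw p i' Bp Iw). rewrite <- E0. auto.
    + apply in_seq in Ic. destruct H as [[E0 _]|[E0 _]].
      * exists c, true, e. repeat split; auto; try lia. intros x Bx Nx. exists a. auto.
      * exists c, false, e. repeat split; auto; try lia. intros x Bx Nx. exists a. auto.
  - intros c p Lc Bp (a & La & Ea & Ba) (a' & La' & Ea' & Ba').
    destruct (Dis a La a' La' c) as [?|[?|F]]; [apply in_seq; lia|tauto|tauto|].
    exact (formally_disjoint_ball _ _ _ F Ba Ba').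
  - intros c p Lc Bp Pc (a & La & Ea & Ba).
    (* In the second case the point lies in [T], hence in a ball of the cover [t]; this ball is not
       in [w], as the point belongs to the cell, so it is formally disjoint from every ball of
       V_{n-1}. *)
    destruct (Flo c p Lc Bp Pc) as [[i [Ii Bi]]|[-> Tp]].
    + destruct (Adm a La) as [[? _]|[[? _]|[c' [Ic [[? _]|[? F]]]]]]; try (try apply in_seq in Ic; lia).
      replace c' with c in F by lia. exact (formally_disjoint_ball _ _ _ (F i Ii) Ba Bi).
    + destruct (Ht _ Tp) as [e [Le Be]]. change (ball (sigma t e) (f p)) in Be.
      destruct (HT e ltac:(lia)) as [[i' [Iw E0]]|H].
      * apply (Fw p i' Bp Iw). rewrite <- E0. auto.
      * destruct (H a La) as [?|F]; [tauto|]. exact (formally_disjoint_ball _ _ _ F Be Ba).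
  - intros c p Lc Bp Pc (a & La & Ea & Ba). destruct (Fhi c p Lc Bp Pc) as [i [Ii Bi]].
    destruct (Adm a La) as [[? _]|[[? _]|[c' [Ic [[? F]|[? _]]]]]]; try (try apply in_seq in Ic; lia).
    replace c' with c in F by lia. exact (formally_disjoint_ball _ _ _ (F i Ii) Ba Bi).
Qed.

(** A chart point of [K] outside the ball [i0] differs from [p0] by at least [k] in some coordinate
    c; a small ball around it is labelled c if it lies below [p0] and n + c if above. [Sep] and
    [Gap] turn coordinate gaps into distances, and radii below a quarter of these give formal
    disjointness. *)
Lemma certificate_complete (f : (nat -> R) -> X) L U l u gap e0 i0 p0 :
  (1 <= n)%nat -> Defs.compact d K -> Defs.compact d T -> (exists y, T y) ->
  (forall y, T y -> K y) ->
  (forall y, K y -> (exists i, In i w /\ ball i y) \/ exists p, box n L U p /\ f p = y) ->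
  (forall y, T y -> (exists i, In i w /\ ball i y) \/
     exists p, box n L U p /\ f p = y /\ p (Nat.pred n) = 0) ->
  (forall r, 0 < r -> exists e, 0 < e /\ forall p p' c, (c < n)%nat ->
     box n L U p -> box n L U p' -> p c + r <= p' c -> e <= d (f p) (f p')) ->
  (forall p p' c, (c < n)%nat -> box n L U p -> box n L U p' -> p c + gap <= p' c ->
     e0 <= d (f p) (f p')) ->
  0 < e0 ->
  (forall c i, (c < n)%nat -> In i (hi c) ->
     rho i < e0 / 4 /\ exists p, box n L U p /\ ball i (f p) /\ u c + gap <= p c) ->
  (forall c i, (c < n)%nat -> In i (lo c) ->
     rho i < e0 / 4 /\ exists p, box n L U p /\ ball i (f p) /\ p c + gap <= l c) ->
  box n L U p0 -> (forall c, (c < n)%nat -> l c <= p0 c <= u c) -> 0 <= p0 (Nat.pred n) ->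
  (forall eps, 0 < eps -> exists e, 0 < e /\
     forall p, box n L U p -> near n e p0 p -> d (f p0) (f p) < eps) ->
  ball i0 (f p0) -> certificate i0.
Proof.
  intros n1 KC TC [y0 Ty0] TK Kcov Tcov Sep Gap E0 Hhi Hlo Bp0 P0 P0n Fc B0.
  (* [k] and the resulting [e1] shrink with the ball [i0], unlike [gap] and [e0], which are
     fixed. *)
  destruct (ball_open _ _ B0) as [r [r0 Hr]]. destruct (Fc r r0) as [k [k0 Hk]].
  destruct (Sep k k0) as [e1 [E1 He1]].
  assert (M0 := Rmin_l e0 e1). assert (M1 := Rmin_r e0 e1).
  set (e := Rmin e0 e1) in *. assert (E : 0 < e) by (apply Rmin_glb_lt; auto).
  pose (U' := fun c i => rho i < e / 4 /\ exists p, box n L U p /\ ball i (f p) /\ p c + k <= p0 c).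
  pose (V' := fun c i => rho i < e / 4 /\ exists p, box n L U p /\ ball i (f p) /\ p0 c + k <= p c).
  pose (P := fun i b => (b = 2 * n /\ i = i0)%nat \/ (b = 2 * n + 1 /\ In i w)%nat \/
    exists c, (c < n)%nat /\ ((b = c /\ U' c i) \/ (b = (n + c)%nat /\ V' c i))).
  destruct (compact_ball_cover K P KC) as [lK [PK CK]].
  { intros y Ky. destruct (Kcov y Ky) as [[i [Iw Bi]]|[p [Bp <-]]].
    { exists i, (2 * n + 1)%nat. split; auto. right; left. auto. }
    destruct (classic (near n k p0 p)) as [Np|Np].
    { exists i0, (2 * n)%nat. split; [left; auto|]. apply Hr, Hk; auto. }
    destruct (ball_exists (f p) (e / 4)) as [i [Bi Ri]]; [lra|].
    apply not_all_ex_not in Np. destruct Np as [c Np]. apply imply_to_and in Np.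
    destruct Np as [Lc Np]. apply Rnot_lt_le in Np.
    destruct (Rle_lt_dec (p c) (p0 c)) as [S'|S'].
    - rewrite Rabs_pos_eq in Np by lra. exists i, c. split; auto. right; right. exists c. split; auto.
      left. split; auto. split; auto. exists p. repeat split; auto; try apply Bp; auto. lra.
    - rewrite Rabs_left in Np by lra. exists i, (n + c)%nat. split; auto. right; right. exists c. split; auto.
      right. split; auto. split; auto. exists p. repeat split; auto; try apply Bp; auto. lra. }
  (* Chart points of [T] have last coordinate 0, which is at most that of [p0], so they stay at
     least [k] below the points of V_{n-1}; the radius e/4 then suffices. *)
  destruct (compact_ball_cover (A := unit) T (fun i _ => In i w \/ (rho i < e / 4 /\
    exists p, box n L U p /\ ball i (f p) /\ p (Nat.pred n) = 0)) TC) as [lT [PT CT]].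
  { intros y Ty. destruct (Tcov y Ty) as [[i [Iw Bi]]|[p [Bp [<- Z]]]].
    { exists i, tt. auto. }
    destruct (ball_exists (f p) (e / 4)) as [i [Bi Ri]]; [lra|].
    exists i, tt. split; auto. right. split; auto. exists p. auto. }
  destruct (code_of_pairs lK) as [j [g [Hj Cj]]].
  { destruct (CK y0 (TK _ Ty0)) as [i [b [I _]]]. destruct lK; [destruct I|discriminate]. }
  destruct (code_of_list (map fst lT)) as [t [Ht Ct]].
  { destruct (CT y0 Ty0) as [i [b [I _]]]. destruct lT; [destruct I|discriminate]. }
  assert (Lab : forall a, (a < S (eta j))%nat -> P (sigma j a) (sigma g a)) by auto.
  exists j, g, t. split; [split|split; [|split]].
  - intros y Ky. destruct (CK y Ky) as [i [b [I B]]]. destruct (Cj i b I) as [a [La <-]].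
    exists a. split; [lia|exact B].
  - intros y Ty. destruct (CT y Ty) as [i [b [I B]]].
    destruct (Ct i) as [a [La <-]]; [apply in_map_iff; exists (i, b); auto|].
    exists a. split; [lia|exact B].
  - intros a La. destruct (Lab a La) as [H|[[H I]|[c [Lc [[H (Ri & p & Bp & Bi & Pc)]|[H (Ri & p & Bp & Bi & Pc)]]]]]].
    + left; auto.
    + right; left. split; auto. exists (sigma j a). auto.
    + right; right. exists c. split; [apply in_seq; lia|]. left. split; auto. intros i' Ii'.
      destruct (Hhi c i' Lc Ii') as (Ri' & p' & Bp' & Bi' & Pc'). specialize (P0 c Lc).
      apply (formally_disjoint_far e0 _ _ _ _ Bi Bi'); [lra|lra|]. apply Gap with c; auto. lra.
    + right; right. exists c. split; [apply in_seq; lia|]. right. split; auto. intros i' Ii'.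
      destruct (Hlo c i' Lc Ii') as (Ri' & p' & Bp' & Bi' & Pc'). specialize (P0 c Lc).
      apply (formally_disjoint_far e0 _ _ _ _ Bi Bi'); [lra|lra|]. rewrite d_sym. apply Gap with c; auto. lra.
  - intros a La a' La' c Ic. apply in_seq in Ic.
    destruct (Nat.eq_dec (sigma g a) c) as [Ea|]; auto.
    destruct (Nat.eq_dec (sigma g a') (n + c)) as [Ea'|]; auto. right; right.
    destruct (Lab a La) as [[H _]|[[H _]|[c1 [Lc1 [[H (Ri & p & Bp & Bi & Pc)]|[H _]]]]]]; try lia.
    destruct (Lab a' La') as [[H' _]|[[H' _]|[c2 [Lc2 [[H' _]|[H' (Ri' & p' & Bp' & Bi' & Pc')]]]]]]; try lia.
    replace c1 with c in Pc by lia. replace c2 with c in Pc' by lia.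
    apply (formally_disjoint_far e _ _ _ _ Bi Bi'); [lra|lra|].
    apply Rle_trans with e1; [lra|]. apply He1 with c; auto. lra.
  - intros b Lb. specialize (Ht b Lb). apply in_map_iff in Ht. destruct Ht as [[i v] [Ei I]].
    simpl in Ei. subst i. destruct (PT _ _ I) as [Iw|(Ri & p & Bp & Bi & Pc)].
    + left. exists (sigma t b). auto.
    + right. intros a La.
      destruct (Nat.eq_dec (sigma g a) (n + Nat.pred n)) as [Ea|]; auto. right.
      destruct (Lab a La) as [[H' _]|[[H' _]|[c2 [Lc2 [[H' _]|[H' (Ri' & p' & Bp' & Bi' & Pc')]]]]]]; try lia.
      replace c2 with (Nat.pred n) in Pc' by lia.
      apply (formally_disjoint_far e _ _ _ _ Bi Bi'); [lra|lra|].
      apply Rle_trans with e1; [lra|]. apply He1 with (Nat.pred n); auto. lra.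
Qed.
End Certificate.

(** * Choice of cells and finite data in the chart *)

Lemma computable_nbhd (K T : X -> Prop) x U n f :
  semi_computable_compact d alpha q tau1 tau2 sigma eta K ->
  semi_computable_compact d alpha q tau1 tau2 sigma eta T ->
  (forall y, T y -> K y) -> nbhd_in d K U x -> (1 <= n)%nat ->
  homeo_H d n f U -> maps_boundary_onto n f U T ->
  exists N, nbhd_in d K N x /\ computable_up_to d alpha sigma eta N K.
Proof.
  intros SK ST TK (UK & Kx & Ux & r0 & r0pos & Hr0) n1 (fU & fsurj & finj & fcont & finv) (bd1 & bd2).
  assert (SK' := SK). destruct SK' as [KC Kce]. destruct ST as [TC Tce].
  assert (cont : forall t eps, in_H n t -> 0 < eps -> exists e, 0 < e /\
    forall p, in_H n p -> near n e t p -> d (f t) (f p) < eps).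
  { intros t eps Ht E. destruct (fcont t eps Ht E) as [dl [Dl Hd]].
    assert (P := pos_INR n). assert (Q0 : 0 < dl / (INR n + 1)) by (apply Rdiv_lt_0_compat; lra).
    exists (dl / (INR n + 1)). split; auto.
    intros p Hp Np. apply Hd; auto. eapply Rle_lt_trans.
    - apply eucl_le with (a := dl / (INR n + 1)); [lra|]. intros i Li. apply Rlt_le, Np, Li.
    - replace dl with (INR n * (dl / (INR n + 1)) + dl / (INR n + 1)) at 2 by (field; lra). lra. }
  destruct (fsurj x Ux) as [p0 [Hp0 fp0]].
  destruct (cont p0 (r0 / 2) Hp0 ltac:(lra)) as [e1 [E1 He1]].
  (* The bound by [e1] keeps the image of the cell of radius 3e within [r0 / 2] of [x]. The
     alternative for the last coordinate keeps that cell off the bottom face unless its centre lies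
     on it. *)
  assert (He : exists e, 0 < e /\ 4 * e <= e1 /\ (p0 (Nat.pred n) = 0 \/ 4 * e < p0 (Nat.pred n))).
  { destruct Hp0 as [_ [Pp|Pz]].
    - exists (Rmin (e1 / 4) (p0 (Nat.pred n) / 5)).
      assert (A := Rmin_l (e1 / 4) (p0 (Nat.pred n) / 5)).
      assert (B := Rmin_r (e1 / 4) (p0 (Nat.pred n) / 5)).
      split; [apply Rmin_glb_lt; lra|lra].
    - exists (e1 / 4). split; [lra|]. split; [lra|auto]. }
  destruct He as [e [E [Ee1 Ep0]]].
  (* [L s] and [V s] bound the cell of radius s e about [p0], cut off at the boundary of the
     half-space. *)
  pose (L := fun s i => if Nat.eq_dec i (Nat.pred n) then Rmax 0 (p0 i - s * e) else p0 i - s * e).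
  pose (V := fun s i => p0 i + s * e).
  assert (boxE : forall s p, box n (L s) (V s) p <->
    in_H n p /\ forall i, (i < n)%nat -> p0 i - s * e <= p i <= p0 i + s * e).
  { intros s p. unfold box, in_H. split.
    - intros [R H]. split; [split; auto|].
      + destruct (H (Nat.pred n) ltac:(lia)) as [H' _]. unfold L in H'.
        destruct (Nat.eq_dec (Nat.pred n) (Nat.pred n)); [|tauto].
        eapply Rle_trans; [apply Rmax_l|exact H'].
      + intros i Li. destruct (H i Li) as [H' H'']. split; [|exact H'']. unfold L in H'.
        destruct (Nat.eq_dec i (Nat.pred n)); auto. eapply Rle_trans; [apply Rmax_r|exact H'].
    - intros [[R Z] H]. split; auto. intros i Li. destruct (H i Li) as [H' H'']. split; [|exact H''].
      unfold L. destruct (Nat.eq_dec i (Nat.pred n)) as [->|]; auto. apply Rmax_lub; auto. }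
  assert (boxH : forall s p, box n (L s) (V s) p -> in_H n p) by (intros s p B; apply boxE in B; tauto).
  assert (box23 : forall p, box n (L 2) (V 2) p -> box n (L 3) (V 3) p).
  { intros p B. apply boxE in B. apply boxE. split; [tauto|]. intros i Li. destruct B as [_ B].
    specialize (B i Li). lra. }
  assert (box_near : forall p p', box n (L 2) (V 2) p -> in_H n p' -> near n e p p' -> box n (L 3) (V 3) p').
  { intros p p' B H' N. apply boxE in B. apply boxE. split; auto. intros i Li. destruct B as [_ B].
    specialize (B i Li). specialize (N i Li). apply Rabs_def2 in N. lra. }
  assert (Bp0 : box n (L 2) (V 2) p0).
  { apply boxE. split; auto. intros. lra. }
  (* Uniform continuity of the inverse chart, against all of [K] and not only [U]: a point of [K]
     near the image of the cell is close enough to [x] to lie in [U] by [Hr0]. *)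
  assert (inv : forall g, 0 < g -> exists h, 0 < h /\ forall t, box n (L 3) (V 3) t ->
    forall y, K y -> d (f t) y < h -> exists p, in_H n p /\ f p = y /\ near n g t p).
  { intros g G. apply box_uniform.
    - intros t h h' Ht Lh y Ky D. apply Ht; auto. lra.
    - intros t Bt. assert (Ht := boxH _ _ Bt).
      destruct (finv t (g / 2) Ht ltac:(lra)) as [h1 [H1 Hh1]].
      destruct (cont t (Rmin h1 r0 / 2) Ht) as [h2 [H2 Hh2]].
      { assert (0 < Rmin h1 r0) by (apply Rmin_glb_lt; auto). lra. }
      assert (A1 := Rmin_l h1 r0). assert (A2 := Rmin_r h1 r0).
      assert (A3 : 0 < Rmin h1 r0) by (apply Rmin_glb_lt; auto).
      exists (Rmin (Rmin h1 r0 / 2) (Rmin h2 (g / 2))).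
      assert (B1 := Rmin_l (Rmin h1 r0 / 2) (Rmin h2 (g / 2))).
      assert (B2 := Rmin_r (Rmin h1 r0 / 2) (Rmin h2 (g / 2))).
      assert (B3 := Rmin_l h2 (g / 2)). assert (B4 := Rmin_r h2 (g / 2)).
      split; [repeat apply Rmin_glb_lt; lra|].
      intros s Bs Ns y Ky Dy.
      assert (Dts : d (f t) (f s) < Rmin h1 r0 / 2).
      { apply Hh2; [apply (boxH _ _ Bs)|]. eapply near_le; [exact Ns|lra]. }
      assert (Dty : d (f t) y < Rmin h1 r0) by (assert (H := d_tri (f t) (f s) y); lra).
      assert (Dxs : d x (f s) < r0 / 2).
      { rewrite <- fp0. apply He1; [apply (boxH _ _ Bs)|]. intros i Li. apply boxE in Bs.
        destruct Bs as [_ Bs]. specialize (Bs i Li). apply Rabs_def1; lra. }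
      assert (Uy : U y).
      { apply Hr0; auto. assert (H := d_tri x (f s) y). lra. }
      destruct (fsurj y Uy) as [p [Hp <-]]. exists p. split; [auto|split; [auto|]].
      apply near_le with (g / 2 + g / 2); [|lra].
      apply near_trans with t.
      + apply near_sym. eapply near_le; [exact Ns|lra].
      + intros i Li. eapply Rle_lt_trans; [apply (eucl_coord n t p i Li)|]. apply Hh1; auto. lra. }
  assert (sep : forall g, 0 < g -> exists h, 0 < h /\ forall p p' c, (c < n)%nat ->
     box n (L 3) (V 3) p -> box n (L 3) (V 3) p' -> p c + g <= p' c -> h <= d (f p) (f p')).
  { intros g G. destruct (inv g G) as [h [H Hh]]. exists h. split; auto.
    intros p p' c Lc Bp Bp' Le. apply Rnot_lt_le. intros D.
    assert (Hp' := boxH _ _ Bp').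
    destruct (Hh p Bp (f p') (UK _ (fU _ Hp')) D) as [p'' [Hp'' [Ef N]]].
    apply finj in Ef; auto. subst p''. specialize (N c Lc). apply Rabs_def2 in N. lra. }
  destruct (inv e E) as [hw [Hw Hhw]].
  destruct (small_ball_cover K (hw / 2) KC ltac:(lra)) as [lw [Rw Cw]].
  (* [w] keeps the balls that miss the image of the cell of radius 2e. Two points in a discarded
     ball are less than [hw] apart, so its points of [K] come from within e of that cell, hence from
     the cell of radius 3e. *)
  destruct (filter_classical lw (fun i => ~ exists p, box n (L 2) (V 2) p /\ ball i (f p))) as [w Iw].
  assert (Kcov : forall y, K y -> (exists i, In i w /\ ball i y) \/
    exists p, box n (L 3) (V 3) p /\ f p = y).
  { intros y Ky. destruct (Cw y Ky) as [i [Ii Bi]].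
    destruct (classic (exists p, box n (L 2) (V 2) p /\ ball i (f p))) as [[p [Bp Bip]]|N].
    - right. destruct (Hhw p (box23 _ Bp) y Ky) as [p' [Hp' [<- Np]]].
      + specialize (Rw i Ii). unfold ball in *. assert (H := d_tri (f p) (lam i) y).
        rewrite (d_sym (lam i) y) in H. lra.
      + exists p'. split; auto. apply (box_near p); auto.
    - left. exists i. split; auto. apply Iw. auto. }
  assert (Tcov : forall y, T y -> (exists i, In i w /\ ball i y) \/
    exists p, box n (L 3) (V 3) p /\ f p = y /\ p (Nat.pred n) = 0).
  { intros y Ty. destruct (Kcov y (TK y Ty)) as [H|[p [Bp <-]]]; auto. right.
    exists p. split; [auto|split; [auto|]]. assert (Hp := boxH _ _ Bp).
    destruct (bd2 _ (fU p Hp) Ty) as [p' [[R' Z'] Ef]].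
    apply finj in Ef; auto; [subst p'; auto|]. split; auto. lra. }
  destruct (sep e E) as [e0 [E0 He0]].
  destruct (small_ball_cover K (e0 / 4) KC ltac:(lra)) as [ls [Rs Cs]].
  destruct (choice _ (fun c => filter_classical ls (fun i => exists p, box n (L 2) (V 2) p /\
    ball i (f p) /\ p c = V 2 c))) as [hi Ihi].
  (* When [p0] lies on the boundary, the list for the bottom face is left empty: there the cover of
     [T] takes over. *)
  destruct (choice _ (fun c => filter_classical ls (fun i => exists p, box n (L 2) (V 2) p /\
    ball i (f p) /\ p c = L 2 c /\ ~ (c = Nat.pred n /\ p0 (Nat.pred n) = 0)))) as [lo Ilo].
  assert (Bp03 := box23 _ Bp0).
  destruct (inv e E) as [hz [Hz Hhz]].
  (* With this radius every point of [K] in the closed ball [z] is within [hz] of [x] and so comes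
     from the cell of radius e. *)
  destruct (ball_exists x (hz / 2)) as [z [Bz Rz]]; [lra|].
  exists (fun y => K y /\ ball z y). split.
  { split; [tauto|split; [auto|split; [auto|]]].
    destruct (ball_open z x Bz) as [r [R Hr]]. exists r. auto. }
  apply computable_up_to_of_certificates with (cert := certificate K T n w lo hi) (x := x); auto.
  - apply sd_certificate; auto.
  - intros i. apply certificate_sound with (f := f) (l := L 2) (u := V 2).
    + intros j Lj. unfold L, V. destruct (Nat.eq_dec j (Nat.pred n)) as [->|]; [|lra].
      destruct Hp0 as [_ P]. apply Rmax_lub_lt; lra.
    + intros p Bp. apply UK, fU, (boxH _ _ Bp).
    + intros t eps Bt Ep. destruct (cont t eps (boxH _ _ Bt) Ep) as [h [H Hh]].
      exists h. split; auto. intros p Bp. apply Hh, (boxH _ _ Bp).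
    + intros p j Bp Ij Bj. apply Iw in Ij. apply (proj2 Ij). eauto.
    + intros c p Lc Bp Pc. destruct (Cs (f p) (UK _ (fU _ (boxH _ _ Bp)))) as [j [Ij Bj]].
      exists j. split; auto. apply Ihi. split; eauto.
    + intros c p Lc Bp Pc. destruct (classic (c = Nat.pred n /\ p0 (Nat.pred n) = 0)) as [[-> Z]|N].
      * right. split; auto. apply bd1. split; [apply (boxH _ _ Bp)|]. rewrite Pc. unfold L.
        destruct (Nat.eq_dec _ _); [|tauto]. rewrite Z. apply Rmax_left. lra.
      * left. destruct (Cs (f p) (UK _ (fU _ (boxH _ _ Bp)))) as [j [Ij Bj]].
        exists j. split; auto. apply Ilo. split; eauto.
  - intros y i Ky Dy Bi.
    destruct (Hhz p0 Bp03 y Ky) as [p [Hp [<- Np]]].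
    { rewrite fp0. unfold ball in *. assert (H := d_tri x (lam z) y).
      rewrite (d_sym (lam z) y) in H. lra. }
    assert (Np' : forall c, (c < n)%nat -> p0 c - 1 * e <= p c <= p0 c + 1 * e).
    { intros c Lc. specialize (Np c Lc). apply Rabs_def2 in Np. lra. }
    assert (Bp := proj2 (boxE 1 p) (conj Hp Np')).
    apply certificate_complete with (f := f) (L := L 3) (U := V 3) (l := L 1) (u := V 1)
      (gap := e) (e0 := e0) (p0 := p); auto.
    (* The image of the origin shows that [T] is nonempty; only nonempty covers have codes. *)
    + exists (f (fun _ => 0)). apply bd1. split; auto. intros j _. auto.
    + intros c j Lc Ij. apply Ihi in Ij. destruct Ij as [Ij [p' [Bp' [Bj Pc]]]]. split; auto.
      exists p'. split; [auto|split; [auto|]]. rewrite Pc. unfold V. lra.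
    + intros c j Lc Ij. apply Ilo in Ij. destruct Ij as [Ij [p' [Bp' [Bj [Pc N]]]]]. split; auto.
      exists p'. split; [auto|split; [auto|]]. rewrite Pc. unfold L.
      destruct (Nat.eq_dec c (Nat.pred n)) as [->|]; [|lra].
      destruct Ep0 as [Z|P]; [tauto|]. rewrite !Rmax_right by lra. lra.
    + apply (box_near p0); auto.
    + intros c Lc. apply Bp, Lc.
    + apply Hp.
    + intros eps Ep. destruct (cont p eps Hp Ep) as [h [H Hh]]. exists h. split; auto.
      intros p' Bp'. apply Hh, (boxH _ _ Bp').
Qed.

End Space.
End Computable.

Theorem theorem5p7 (X : Type) (d : X -> X -> R) (alpha : nat -> X)
  (q : nat -> Q) (tau1 tau2 : nat -> nat) (sigma : nat -> nat -> nat) (eta : nat -> nat)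
  (S T : X -> Prop) (x : X) :
  computable_metric_space d alpha ->
  enum_data q tau1 tau2 sigma eta ->
  semi_computable_compact d alpha q tau1 tau2 sigma eta S ->
  semi_computable_compact d alpha q tau1 tau2 sigma eta T ->
  (forall y, T y -> S y) ->
  S x ->
  (exists U, nbhd_in d S U x /\
     exists (n : nat) (f : (nat -> R) -> X),
       (1 <= n)%nat /\ homeo_H d n f U /\ maps_boundary_onto n f U T) ->
  exists N, nbhd_in d S N x /\ computable_up_to d alpha sigma eta N S.
Proof.
  intros CMS ED SK ST TS _ [U [NU [n [f [n1 [Hf Bd]]]]]].
  exact (computable_nbhd q tau1 tau2 sigma eta ED d alpha CMS S T x U n f SK ST TS NU n1 Hf Bd).
Qed.
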